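(* Consider, for $x\ge0$, the regularized system $$\dot x=1,\qquad \epsilon\dot v=-a\epsilon v-\big[1+(1+\psi(v))\cos\pi x\big]\sin\tfrac{\pi x}{2}.$$ For all $a,\epsilon>0$ with $a\gg1$ and $\epsilon\ll1$ (i.e. there is $a_1>0$ such that for every $a>a_1$ there is $\epsilon_0>0$ such that for every $\epsilon\in(0,\epsilon_0)$), this system has a sliding $4$-periodic solution. This solution is locally asymptotically stable, and the Lipschitz constant of the associated Poincaré (return) map is exponentially small in $\epsilon$.
   Context: $\psi:\mathbb{R}\to\mathbb{R}$ is a transition function: $C^1$ on $\mathbb{R}$ and $C^2$ on $[-1,1]$, with $\psi(v)=\operatorname{sign}(v)$ for $|v|\ge1$, $\psi'(v)>0$ for $|v|<1$, and $\operatorname{sign}\psi''(v)=-\operatorname{sign}(v)$ at $|v|=1$. The switching layer is $\{|v|<1\}$; the critical manifold inside it is $\Lambda_0^L=\{|v|<1,\ \psi(v)=-1-\sec\pi x,\ x\in(\frac23+2n,\frac43+2n)\}$, attracting for $x\in(\frac83+4n,\frac{10}{3}+4n)$. A periodic solution is sliding if part of it evolves inside the layer along (close to) $\Lambda_0^L$. *)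

(* Defs.v *)
From Stdlib Require Import Reals Lra ZArith.
From Coquelicot Require Import Coquelicot.
Open Scope R_scope.

Definition transition (psi : R -> R) : Prop :=
  exists psi1 psi2 : R -> R,
    (forall v, is_derive psi v (psi1 v)) /\
    (forall v, continuous psi1 v) /\
    (forall v, -1 <= v <= 1 ->
       filterlim (fun w => (psi1 w - psi1 v) / (w - v))
         (within (fun w => -1 <= w <= 1 /\ w <> v) (locally v))
         (locally (psi2 v))) /\
    (forall v, -1 <= v <= 1 ->
       filterlim psi2 (within (fun w => -1 <= w <= 1) (locally v))
         (locally (psi2 v))) /\
    (forall v, 1 <= v -> psi v = 1) /\
    (forall v, v <= -1 -> psi v = -1) /\
    (forall v, Rabs v < 1 -> 0 < psi1 v) /\
    psi2 1 < 0 /\ 0 < psi2 (-1).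

(* Since xdot = 1, we parametrize by x. The v-equation
     eps v' = - a eps v - [1 + (1 + psi v) cos(pi x)] sin(pi x / 2)
   becomes v' = F psi a eps x v. *)
Definition F (psi : R -> R) (a eps x v : R) : R :=
  - a * v - (1 + (1 + psi v) * cos (PI * x)) * sin (PI * x / 2) / eps.

Definition is_solution (psi : R -> R) (a eps : R) (u : R -> R) (S : R -> Prop) : Prop :=
  forall x, S x -> is_derive u x (F psi a eps x (u x)).

(* critical manifold Lambda_0^L : psi(v) = -1 - sec(pi x), |v|<1,
   x in (2/3 + 2n, 4/3 + 2n) *)
Definition crit (x : R) : R := -1 - / cos (PI * x).

Definition sliding (psi : R -> R) (eps K ell : R) (v : R -> R) : Prop :=
  exists (n : Z) (x1 x2 : R),
    0 <= x1 /\ 2/3 + 2 * IZR n < x1 /\ x1 + ell <= x2 /\ x2 < 4/3 + 2 * IZR n /\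
    forall x, x1 <= x <= x2 ->
      Rabs (v x) < 1 /\ Rabs (psi (v x) - crit x) <= K * eps.

Definition loc_asym_stable (psi : R -> R) (a eps : R) (v : R -> R) : Prop :=
  (forall eta, 0 < eta -> exists d, 0 < d /\
     forall u, is_solution psi a eps u (fun x => 0 <= x) ->
       Rabs (u 0 - v 0) < d -> forall x, 0 <= x -> Rabs (u x - v x) < eta) /\
  (exists d, 0 < d /\
     forall u, is_solution psi a eps u (fun x => 0 <= x) ->
       Rabs (u 0 - v 0) < d -> is_lim (fun x => u x - v x) p_infty 0).

(* Main.v *)
(** Write N = 1/eps, m(x) = cos(pi x) sin(pi x / 2), and let w be the difference
    of two solutions. As psi is increasing, w w' = - a w^2 - N m (psi u1 - psi u2) w,
    so |w| decreases wherever m >= 0. For a large every solution starting in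
    |v| <= 4N/a lies below the layer on [1/2, 3/2], where psi is constant, and on
    [35/12, 19/6] it has been driven into a compact part of the layer around
    x = 3, where psi' and m are bounded below: there it is O(eps)-close to the
    critical manifold and |w| contracts at rate of order 1/eps. The remaining
    intervals with m < 0 are [2, 5/2] and [7/2, 4], on which solutions cross the
    layer upwards so fast that the total expansion is bounded uniformly in eps.
    Hence the return map preserves |v| <= 3N/a, has a fixed point there by the
    intermediate value theorem, and contracts exponentially strongly near it. *)

Require Import Defs.
From Stdlib Require Import Reals ZArith Lra Lia.
From Coquelicot Require Import Coquelicot.
Open Scope R_scope.

(** * Differential inequalities *)

(** Inside the layer, differences of solutions may grow at rate L / eps where m < 0, and L >= kap:
    unchecked, this would outweigh the contraction exp(-kap / (12 eps)) gained near x = 3. On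
    [1/2, 3/2] the layer must be avoided altogether, and this is where large a enters: the damping
    has only the time from x = 1/3 to x = 1/2 to forget an initial value of size 4N/a. On [2, 5/2]
    and [7/2, 4] the crossing speed degenerates at x = 2 and x = 4, but the expansion rate carries
    the same vanishing factor sin(pi x / 2), so their ratio stays bounded. The crossing estimate
    compares only solutions at distance at most 1/2. The contraction is therefore local, on an
    exponentially small neighbourhood, and cannot itself produce the fixed point. The gap between
    the radii 3N/a and 4N/a leaves room for this neighbourhood. The thresholds a >= 600 and N >= 100
    a give exp(-a/6) <= 1/101 and exp(-a/12) <= 1/51, and make N/a large compared with the layer
    width. *)

Lemma is_derive_continuity_pt (f : R -> R) (x l : R) :
  is_derive f x l -> continuity_pt f x.
Proof.
  intros H; apply derivable_continuous_pt; exists l; now apply is_derive_Reals.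
Qed.

Lemma nonincreasing_of_derive (f df : R -> R) (p q : R) :
  p <= q ->
  (forall x, p <= x <= q -> is_derive f x (df x)) ->
  (forall x, p <= x <= q -> df x <= 0) ->
  f q <= f p.
Proof.
  intros [Hpq | ->] Hd Hle; [|lra].
  destruct (MVT_cor2 f df p q Hpq) as [c [Hc Hin]].
  { intros c Hc; apply is_derive_Reals; now apply Hd. }
  assert (H0 := Hle c ltac:(lra)).
  nra.
Qed.

Lemma gronwall (f df : R -> R) (k p q : R) :
  p <= q ->
  (forall x, p <= x <= q -> is_derive f x (df x)) ->
  (forall x, p <= x <= q -> df x <= k * f x) ->
  f q <= f p * exp (k * (q - p)).
Proof.
  intros Hpq Hd Hle.
  assert (H : f q * exp (- k * (q - p)) <= f p * exp (- k * (p - p))).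
  { apply (nonincreasing_of_derive (fun x => f x * exp (- k * (x - p)))
      (fun x => (df x - k * f x) * exp (- k * (x - p))) p q Hpq).
    - intros x Hx. specialize (Hd x Hx).
      auto_derive; [now exists (df x)|].
      replace (Derive (fun x0 => f x0) x) with (df x)
        by (symmetry; now apply is_derive_unique).
      unfold Rminus; ring.
    - intros x Hx. specialize (Hle x Hx).
      assert (He := exp_pos (- k * (x - p))). nra. }
  replace (- k * (p - p)) with 0 in H by ring.
  rewrite exp_0 in H.
  replace (f q) with (f q * exp (- k * (q - p)) * exp (k * (q - p))).
  - apply Rmult_le_compat_r; [left; apply exp_pos | lra].
  - rewrite Rmult_assoc, <- exp_plus.
    replace (- k * (q - p) + k * (q - p)) with 0 by ring.
    rewrite exp_0; ring.
Qed.

Lemma gronwall_affine (f df : R -> R) (a b p q : R) :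
  0 < a -> p <= q ->
  (forall x, p <= x <= q -> is_derive f x (df x)) ->
  (forall x, p <= x <= q -> df x <= - a * f x + b) ->
  f q <= b / a + (f p - b / a) * exp (- a * (q - p)).
Proof.
  intros Ha Hpq Hd Hle.
  assert (H := gronwall (fun x => f x - b / a) df (- a) p q Hpq).
  cbv beta in H.
  enough (f q - b / a <= (f p - b / a) * exp (- a * (q - p))) by lra.
  apply H.
  - intros x Hx. specialize (Hd x Hx).
    auto_derive; [now exists (df x)|].
    rewrite Rmult_1_l; now apply is_derive_unique.
  - intros x Hx. specialize (Hle x Hx).
    replace (- a * (f x - b / a)) with (- a * f x + b) by (field; lra).
    lra.
Qed.

(** For the Picard operator this replaces estimates of integrals by estimates of derivatives. *)
Lemma abs_increment_le (f df g dg : R -> R) (p q : R) :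
  p <= q ->
  (forall x, p <= x <= q -> is_derive f x (df x)) ->
  (forall x, p <= x <= q -> is_derive g x (dg x)) ->
  (forall x, p <= x <= q -> Rabs (df x) <= dg x) ->
  Rabs (f q - f p) <= g q - g p.
Proof.
  intros Hpq Hf Hg Hle.
  assert (H1 := nonincreasing_of_derive (fun x => f x - g x) (fun x => df x - dg x)
    p q Hpq).
  assert (H2 := nonincreasing_of_derive (fun x => - f x - g x)
    (fun x => - df x - dg x) p q Hpq).
  cbv beta in H1, H2.
  assert (H : forall x, p <= x <= q -> - dg x <= df x <= dg x).
  { intros x Hx. apply Rabs_le_between. now apply Hle. }
  apply Rabs_le_between.
  enough (f q - g q <= f p - g p /\ - f q - g q <= - f p - g p) by lra.
  split; [apply H1 | apply H2]; intros x Hx; try (specialize (H x Hx); lra).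
  - apply (is_derive_minus f g); auto.
  - apply (is_derive_minus (fun x => - f x) g); auto.
    apply (is_derive_opp f); auto.
Qed.

Lemma locally_right_of_neg_derive (f : R -> R) (m l : R) :
  is_derive f m l -> l < 0 ->
  exists d, 0 < d /\ forall x, m < x < m + d -> f x < f m.
Proof.
  intros H Hl. apply is_derive_Reals in H.
  destruct (H (- l / 2) ltac:(lra)) as [d Hd].
  exists d; split; [apply cond_pos|].
  intros x Hx.
  specialize (Hd (x - m) ltac:(lra)).
  replace (m + (x - m)) with x in Hd by ring.
  assert (Hx' : Rabs (x - m) < d) by (rewrite Rabs_right; lra).
  specialize (Hd Hx').
  apply Rabs_def2 in Hd.
  assert (Hq : (f x - f m) / (x - m) < 0) by lra.
  assert (f x - f m = (f x - f m) / (x - m) * (x - m)) by (field; lra).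
  nra.
Qed.

(** If [f x0 > c], let m be the supremum of the times up to x0 with [f <= c]. Continuity gives
    [f m <= c]; then continuity again, or the negative derivative if [f m = c], carries the
    inequality beyond m, a contradiction. The sign of [df] matters only on the level c itself. *)
Lemma upper_barrier (f df : R -> R) (c p q : R) :
  (forall x, p <= x <= q -> is_derive f x (df x)) ->
  (forall x, p <= x <= q -> f x = c -> df x < 0) ->
  f p <= c ->
  forall x, p <= x <= q -> f x <= c.
Proof.
  intros Hd Hc Hp x0 Hx0.
  destruct (Rle_lt_dec (f x0) c) as [|Hgt]; [easy|exfalso].
  set (S t := p <= t <= x0 /\ f t <= c).
  destruct (completeness S) as [m [Hub Hlub]].
  { exists x0. intros t [Ht _]. lra. }
  { exists p. split; [lra | easy]. }
  assert (Hpm : p <= m) by (apply Hub; split; [lra | easy]).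
  assert (Hm0 : m <= x0) by (apply Hlub; intros t [Ht _]; lra).
  assert (Hcont : continuity_pt f m).
  { eapply is_derive_continuity_pt. apply Hd; lra. }
  assert (Hfm : f m <= c).
  { destruct (Rle_lt_dec (f m) c) as [|Hm]; [easy|exfalso].
    destruct (Hcont (f m - c) ltac:(lra)) as [d [Hd0 Hd1]].
    assert (m <= m - d); [|lra].
    apply Hlub. intros t [Ht Hft].
    destruct (Rle_lt_dec t (m - d)) as [|Htd]; [easy|exfalso].
    assert (Htm : t <= m) by (apply Hub; now split).
    destruct (Req_dec t m) as [->|Hne]; [lra|].
    assert (Hn : Rabs (f t - f m) < f m - c).
    { apply (Hd1 t). split; [split; [exact I | lra]|].
      simpl. unfold Rdist. rewrite Rabs_left; lra. }
    apply Rabs_def2 in Hn. lra. }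
  assert (Hlt : m < x0).
  { destruct Hm0 as [|Heq]; [easy|]. rewrite Heq in Hfm. lra. }
  assert (Hr : exists d, 0 < d /\ forall x, m < x < m + d -> f x <= c).
  { destruct Hfm as [Hfm | Hfm].
    - destruct (Hcont (c - f m) ltac:(lra)) as [d [Hd0 Hd1]].
      exists d. split; [easy|]. intros x Hx.
      assert (Hn : Rabs (f x - f m) < c - f m).
      { apply (Hd1 x). split; [split; [exact I | lra]|].
        simpl. unfold Rdist. rewrite Rabs_right; lra. }
      apply Rabs_def2 in Hn. lra.
    - destruct (locally_right_of_neg_derive f m (df m)) as [d [Hd0 Hd1]].
      + apply Hd; lra.
      + apply Hc; [lra | easy].
      + exists d. split; [easy|]. intros x Hx. specialize (Hd1 x Hx). lra. }
  destruct Hr as [d [Hd0 Hd1]].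
  set (e := Rmin (d / 2) (x0 - m)).
  assert (0 < e) by (apply Rmin_glb_lt; lra).
  assert (e <= d / 2) by apply Rmin_l.
  assert (e <= x0 - m) by apply Rmin_r.
  assert (m + e <= m); [|lra].
  apply Hub. split; [lra|]. apply Hd1; lra.
Qed.

Lemma lower_barrier (f df : R -> R) (c p q : R) :
  (forall x, p <= x <= q -> is_derive f x (df x)) ->
  (forall x, p <= x <= q -> f x = c -> 0 < df x) ->
  c <= f p ->
  forall x, p <= x <= q -> c <= f x.
Proof.
  intros Hd Hc Hp x Hx.
  apply Ropp_le_cancel.
  apply (upper_barrier (fun x => - f x) (fun x => - df x) (- c) p q); [| |lra|easy].
  - intros y Hy. apply (is_derive_opp f); auto.
  - intros y Hy Hfy. specialize (Hc y Hy). lra.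
Qed.

Lemma exp_le (x y : R) : x <= y -> exp x <= exp y.
Proof.
  intros [H | ->]; [left; now apply exp_increasing | apply Rle_refl].
Qed.

Lemma exp_neg_le_inv (t : R) : 0 <= t -> exp (- t) <= / (1 + t).
Proof.
  intros Ht. rewrite exp_Ropp.
  apply Rinv_le_contravar; [lra|].
  destruct Ht as [Ht | <-].
  - left. now apply exp_ineq1; lra.
  - rewrite exp_0; lra.
Qed.

Lemma Rabs_le_of_sqr_le (x y : R) : 0 <= y -> x ^ 2 <= y ^ 2 -> Rabs x <= y.
Proof.
  intros Hy H. rewrite <- (Rabs_right y) by lra.
  apply Rsqr_le_abs_0. unfold Rsqr. lra.
Qed.

(** * Global existence *)

Lemma continuous_Rmax0 (x : R) : continuous (Rmax 0) x.
Proof.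
  apply (continuous_ext (fun y => (y + Rabs y) * / 2)).
  - intros y. unfold Rmax, Rabs.
    destruct (Rle_dec 0 y), (Rcase_abs y); lra.
  - apply (continuous_mult (fun y => y + Rabs y) (fun _ => / 2)).
    + apply (continuous_plus (fun y => y) Rabs).
      * apply continuous_id.
      * apply continuous_Rabs.
    + apply continuous_const.
Qed.

Section Picard.

Context (f : R -> R -> R) (lam M u0 : R).
Context (lam_gt0 : 0 < lam).
Context (f_lip : forall x u v, Rabs (f x u - f x v) <= lam * Rabs (u - v)).
Context (f_cont : forall g : R -> R, (forall x, continuous g x) ->
  forall x, continuous (fun s => f s (g s)) x).
Context (f_bound : forall x, Rabs (f x u0) <= M).

(* Reading [g] through [Rmax 0] makes the operator depend only on the values
   of [g] on the half-line, while its image is differentiable on all of R. *)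
Let T (g : R -> R) (x : R) : R := u0 + RInt (fun s => f s (g (Rmax 0 s))) 0 x.

Let it (n : nat) : R -> R := Nat.iter n T (fun _ => u0).

Let half_line_continuous (g : R -> R) : Prop :=
  forall x, continuous (fun s => g (Rmax 0 s)) x.

Lemma picard_derive (g : R -> R) (x : R) :
  half_line_continuous g -> is_derive (T g) x (f x (g (Rmax 0 x))).
Proof.
  intros Hg.
  assert (Hc := f_cont _ Hg).
  replace (f x (g (Rmax 0 x))) with (0 + f x (g (Rmax 0 x))) by ring.
  apply (is_derive_plus (fun _ => u0)
    (fun x => RInt (fun s => f s (g (Rmax 0 s))) 0 x)).
  - apply (is_derive_const u0).
  - apply (is_derive_RInt (fun s => f s (g (Rmax 0 s))) _ 0); [|apply Hc].
    apply filter_forall. intros y. apply (@RInt_correct R_CompleteNormedModule).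
    apply (@ex_RInt_continuous R_CompleteNormedModule). intros z _. apply Hc.
Qed.

Lemma picard_continuous (g : R -> R) :
  half_line_continuous g -> half_line_continuous (T g).
Proof.
  intros Hg x.
  apply (continuous_comp (Rmax 0) (T g)); [apply continuous_Rmax0|].
  apply (ex_derive_continuous (T g)). eexists. now apply picard_derive.
Qed.

Lemma picard_0 (g : R -> R) : T g 0 = u0.
Proof. unfold T. rewrite RInt_point. apply Rplus_0_r. Qed.

(** The exponential weight (Bielecki norm) is the point: integrating lam exp(2 lam x) gains a factor
    1/2, so the operator contracts on the whole half-line at once and no continuation of local
    solutions is needed. *)
Lemma picard_contraction (g h : R -> R) (c : R) :
  half_line_continuous g -> half_line_continuous h ->
  (forall x, 0 <= x -> Rabs (g x - h x) <= c * exp (2 * lam * x)) ->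
  forall x, 0 <= x -> Rabs (T g x - T h x) <= c / 2 * exp (2 * lam * x).
Proof.
  intros Hg Hh Hgh x Hx.
  assert (Hc : 0 <= c).
  { specialize (Hgh 0 (Rle_refl 0)). rewrite Rmult_0_r, exp_0 in Hgh.
    assert (Hp := Rabs_pos (g 0 - h 0)). lra. }
  assert (H := abs_increment_le (fun x => T g x - T h x)
    (fun x => f x (g (Rmax 0 x)) - f x (h (Rmax 0 x)))
    (fun x => c / 2 * exp (2 * lam * x)) (fun x => lam * (c * exp (2 * lam * x)))
    0 x Hx).
  cbv beta in H.
  rewrite !picard_0 in H.
  replace (T g x - T h x - (u0 - u0)) with (T g x - T h x) in H by ring.
  rewrite Rmult_0_r, exp_0 in H.
  enough (Rabs (T g x - T h x) <= c / 2 * exp (2 * lam * x) - c / 2 * 1) by lra.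
  apply H.
  - intros y Hy. apply (is_derive_minus (T g) (T h)); now apply picard_derive.
  - intros y Hy. auto_derive; [easy | field].
  - intros y Hy. rewrite Rmax_right by lra.
    eapply Rle_trans; [apply f_lip|].
    apply Rmult_le_compat_l; [lra|]. apply Hgh; lra.
Qed.

Lemma picard_first_step (x : R) :
  0 <= x -> Rabs (T (fun _ => u0) x - u0) <= M / lam * exp (2 * lam * x).
Proof.
  intros Hx.
  assert (HM : 0 <= M) by (eapply Rle_trans; [apply Rabs_pos | apply (f_bound 0)]).
  assert (H := abs_increment_le (T (fun _ => u0)) (fun x => f x u0)
    (fun x => M / lam * exp (2 * lam * x)) (fun x => M * (2 * exp (2 * lam * x)))
    0 x Hx).
  rewrite picard_0, Rmult_0_r, exp_0 in H.
  assert (0 <= M / lam) by (apply Rdiv_le_0_compat; lra).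
  enough (Rabs (T (fun _ => u0) x - u0) <= M / lam * exp (2 * lam * x) - M / lam * 1)
    by lra.
  apply H.
  - intros y Hy. apply (picard_derive (fun _ => u0)).
    intros z. apply continuous_const.
  - intros y Hy. auto_derive; [easy | field; lra].
  - intros y Hy. eapply Rle_trans; [apply f_bound|].
    assert (1 <= exp (2 * lam * y)).
    { rewrite <- exp_0. apply exp_le. nra. }
    nra.
Qed.

Lemma picard_iter_continuous (n : nat) : half_line_continuous (it n).
Proof.
  induction n as [|n IH].
  - intros x. apply continuous_const.
  - now apply picard_continuous.
Qed.

(** The constant 2M/lam solves c = c/2 + M/lam: one contraction plus the first step reproduces
    it. *)
Lemma picard_iter_bound (n : nat) (x : R) :
  0 <= x -> Rabs (it n x - u0) <= 2 * M / lam * exp (2 * lam * x).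
Proof.
  revert x. induction n as [|n IH]; intros x Hx.
  - simpl. rewrite Rminus_eq_0, Rabs_R0.
    assert (HM : 0 <= M) by (eapply Rle_trans; [apply Rabs_pos | apply (f_bound 0)]).
    apply Rmult_le_pos; [apply Rdiv_le_0_compat; lra | left; apply exp_pos].
  - assert (H := picard_contraction (it n) (fun _ => u0) _ (picard_iter_continuous n)
      (picard_iter_continuous 0) IH x Hx).
    assert (H1 := picard_first_step x Hx).
    change (it (S n) x) with (T (it n) x).
    replace (T (it n) x - u0) with
      ((T (it n) x - T (fun _ => u0) x) + (T (fun _ => u0) x - u0)) by ring.
    eapply Rle_trans; [apply Rabs_triang|].
    replace (2 * M / lam) with (2 * M / lam / 2 + M / lam) by (field; lra).
    rewrite Rmult_plus_distr_r. lra.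
Qed.

Lemma picard_iter_cauchy (n k : nat) (x : R) :
  0 <= x ->
  Rabs (it (n + k) x - it n x) <= 2 * M / lam * (/ 2) ^ n * exp (2 * lam * x).
Proof.
  revert x. induction n as [|n IH]; intros x Hx.
  - simpl. rewrite Rmult_1_r. now apply picard_iter_bound.
  - assert (H := picard_contraction (it (n + k)) (it n) _ (picard_iter_continuous _)
      (picard_iter_continuous _) IH x Hx).
    eapply Rle_trans; [apply H|]. simpl. lra.
Qed.

Lemma geometric_eventually_lt (c e : R) :
  0 < e -> exists n, forall m, (n <= m)%nat -> c * (/ 2) ^ m < e.
Proof.
  intros He.
  assert (H : is_lim_seq (fun m => c * (/ 2) ^ m) (c * 0)).
  { apply (is_lim_seq_scal_l _ c 0). apply is_lim_seq_geom.
    rewrite Rabs_right; lra. }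
  rewrite Rmult_0_r in H. apply is_lim_seq_spec in H.
  destruct (H (mkposreal e He)) as [n Hn]. exists n. intros m Hm.
  specialize (Hn m Hm). simpl in Hn. apply Rabs_def2 in Hn. lra.
Qed.

Let u (x : R) : R := real (Lim_seq (fun n => it n x)).

Lemma picard_limit (x : R) :
  0 <= x -> is_lim_seq (fun n => it n x) (u x).
Proof.
  intros Hx. apply Lim_seq_correct', ex_lim_seq_cauchy_corr.
  intros e.
  destruct (geometric_eventually_lt (2 * (2 * M / lam) * exp (2 * lam * x)) e)
    as [n Hn]; [apply cond_pos|].
  exists n. intros p q Hp Hq.
  specialize (Hn n (Nat.le_refl n)).
  assert (H1 := picard_iter_cauchy n (p - n) x Hx).
  assert (H2 := picard_iter_cauchy n (q - n) x Hx).
  replace (n + (p - n))%nat with p in H1 by lia.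
  replace (n + (q - n))%nat with q in H2 by lia.
  apply Rabs_le_between in H1, H2. apply Rabs_def1; lra.
Qed.

Lemma picard_limit_error (n : nat) (x : R) :
  0 <= x -> Rabs (it n x - u x) <= 2 * M / lam * (/ 2) ^ n * exp (2 * lam * x).
Proof.
  intros Hx.
  assert (H : is_lim_seq (fun k => Rabs (it (k + n) x - it n x))
    (Rabs (u x - it n x))).
  { apply (is_lim_seq_abs (fun k => it (k + n)%nat x - it n x) (u x - it n x)).
    apply is_lim_seq_minus'; [|apply is_lim_seq_const].
    apply (is_lim_seq_incr_n (fun k => it k x)). now apply picard_limit. }
  rewrite Rabs_minus_sym.
  apply (is_lim_seq_le _ (fun _ => 2 * M / lam * (/ 2) ^ n * exp (2 * lam * x))
    (Rabs (u x - it n x)) (2 * M / lam * (/ 2) ^ n * exp (2 * lam * x))) in H;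
    [easy | | apply is_lim_seq_const].
  intros k. rewrite Nat.add_comm. now apply picard_iter_cauchy.
Qed.

Lemma picard_limit_continuous : half_line_continuous u.
Proof.
  intros x. apply continuity_pt_filterlim.
  apply (CVU_continuity (fun n y => it n (Rmax 0 y)) _ x (mkposreal 1 Rlt_0_1)).
  - intros e He.
    (* On the unit ball around x the weight is at most its value at |x| + 1, which makes the
       convergence uniform there. *)
    destruct (geometric_eventually_lt (2 * M / lam * exp (2 * lam * (Rabs x + 1))) e He)
      as [n Hn].
    exists n. intros m y Hm Hy. rewrite Rabs_minus_sym.
    eapply Rle_lt_trans; [apply picard_limit_error, Rmax_l|].
    eapply Rle_lt_trans; [|apply (Hn m Hm)].
    assert (Hy' : Rmax 0 y <= Rabs x + 1).
    { unfold Boule in Hy. simpl in Hy. apply Rabs_def2 in Hy.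
      assert (Hx := Rle_abs x). assert (Hx0 := Rabs_pos x).
      apply Rmax_lub; lra. }
    assert (HM : 0 <= M) by (eapply Rle_trans; [apply Rabs_pos | apply (f_bound 0)]).
    assert (0 <= 2 * M / lam) by (apply Rdiv_le_0_compat; lra).
    assert (0 <= (/ 2) ^ m) by (apply pow_le; lra).
    replace (2 * M / lam * exp (2 * lam * (Rabs x + 1)) * (/ 2) ^ m) with
      (2 * M / lam * (/ 2) ^ m * exp (2 * lam * (Rabs x + 1))) by ring.
    apply Rmult_le_compat_l; [now apply Rmult_le_pos|].
    apply exp_le. nra.
  - intros n y _. apply continuity_pt_filterlim.
    apply (picard_iter_continuous n).
  - unfold Boule. simpl. rewrite Rminus_eq_0, Rabs_R0. lra.
Qed.

Lemma picard_fixed_point (x : R) : 0 <= x -> T u x = u x.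
Proof.
  intros Hx.
  assert (H : is_lim_seq (fun n => it (S n) x) (T u x)).
  { apply is_lim_seq_spec. intros e.
    destruct (geometric_eventually_lt (2 * M / lam * / 2 * exp (2 * lam * x)) e)
      as [n Hn]; [apply cond_pos|].
    exists n. intros m Hm.
    assert (H := picard_contraction (it m) u _ (picard_iter_continuous m)
      picard_limit_continuous (picard_limit_error m) x Hx).
    eapply Rle_lt_trans; [apply H|].
    eapply Rle_lt_trans; [|apply (Hn m Hm)]. right; field; lra. }
  assert (H' := picard_limit x Hx).
  apply is_lim_seq_incr_1 in H'.
  apply is_lim_seq_unique in H. apply is_lim_seq_unique in H'.
  rewrite H in H'. now injection H'.
Qed.

Lemma picard_lindelof :
  {v : R -> R | v 0 = u0 /\ forall x, 0 <= x -> is_derive v x (f x (v x))}.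
Proof.
  (* The witness is [T u], not [u]: they agree for x >= 0, but the derivative at 0 is two-sided and
     only [T u] is controlled to the left of 0. *)
  exists (T u). split; [apply picard_0|].
  intros x Hx. rewrite (picard_fixed_point x Hx).
  assert (H := picard_derive u x picard_limit_continuous).
  now rewrite Rmax_right in H.
Qed.

End Picard.

(** * Transition functions *)

Section Transition.

Context (psi psi1 : R -> R).
Context (psi_derive : forall v, is_derive psi v (psi1 v)).
Context (psi1_continuous : forall v, continuous psi1 v).
Context (psi_right : forall v, 1 <= v -> psi v = 1).
Context (psi_left : forall v, v <= -1 -> psi v = -1).
Context (psi1_pos : forall v, Rabs v < 1 -> 0 < psi1 v).

(** Since [psi] factors through this retraction onto the closed layer, monotonicity and the
    Lipschitz bound reduce to the mean value theorem on [-1, 1]. *)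
Let clamp (v : R) : R := Rmax (-1) (Rmin 1 v).

Lemma psi_clamp (v : R) : psi (clamp v) = psi v.
Proof.
  unfold clamp, Rmax, Rmin.
  destruct (Rle_dec 1 v).
  - destruct (Rle_dec (-1) 1); [|lra]. rewrite !psi_right; lra.
  - destruct (Rle_dec (-1) v); [easy|]. rewrite !psi_left; lra.
Qed.

Lemma clamp_bounds (v : R) : -1 <= clamp v <= 1.
Proof.
  unfold clamp, Rmax, Rmin.
  destruct (Rle_dec 1 v); destruct (Rle_dec _ _); lra.
Qed.

Lemma clamp_increment (u v : R) : u <= v -> 0 <= clamp v - clamp u <= v - u.
Proof.
  unfold clamp, Rmax, Rmin. intros H.
  destruct (Rle_dec 1 v), (Rle_dec 1 u);
    repeat (destruct (Rle_dec _ _)); lra.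
Qed.

Lemma psi_mean_value (u v : R) :
  u < v -> exists c, psi v - psi u = psi1 c * (v - u) /\ u < c < v.
Proof.
  intros H. apply MVT_cor2; [easy|].
  intros c _. now apply is_derive_Reals.
Qed.

Lemma psi_increasing (u v : R) : u <= v -> psi u <= psi v.
Proof.
  intros H. rewrite <- (psi_clamp u), <- (psi_clamp v).
  assert (H1 := clamp_increment u v H).
  assert (Hu := clamp_bounds u). assert (Hv := clamp_bounds v).
  destruct (Req_dec (clamp u) (clamp v)) as [->|Hne]; [lra|].
  destruct (psi_mean_value (clamp u) (clamp v)) as [c [Hc Hin]]; [lra|].
  assert (0 < psi1 c) by (apply psi1_pos, Rabs_def1; lra).
  nra.
Qed.

Lemma psi1_bounded : exists L, 0 < L /\ forall v, -1 <= v <= 1 -> psi1 v <= L.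
Proof.
  destruct (continuity_ab_maj psi1 (-1) 1) as [m [Hm Hin]]; [lra| |].
  { intros c _. apply continuity_pt_filterlim, psi1_continuous. }
  exists (psi1 m). split; [|easy].
  apply Rlt_le_trans with (psi1 0).
  - apply psi1_pos. rewrite Rabs_R0. lra.
  - apply Hm. lra.
Qed.

Lemma psi_lipschitz (L : R) :
  0 < L -> (forall v, -1 <= v <= 1 -> psi1 v <= L) ->
  forall u v, Rabs (psi u - psi v) <= L * Rabs (u - v).
Proof.
  intros HL Hb.
  assert (H : forall u v, u <= v -> psi v - psi u <= L * (v - u)).
  { intros u v H.
    rewrite <- (psi_clamp u), <- (psi_clamp v).
    assert (H1 := clamp_increment u v H).
    assert (Hu := clamp_bounds u). assert (Hv := clamp_bounds v).
    destruct (Req_dec (clamp u) (clamp v)) as [->|Hne].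
    - rewrite Rminus_eq_0. apply Rmult_le_pos; lra.
    - destruct (psi_mean_value (clamp u) (clamp v)) as [c [Hc Hin]]; [lra|].
      assert (psi1 c <= L) by (apply Hb; lra).
      nra. }
  intros u v. destruct (Rle_lt_dec u v) as [Huv|Huv].
  - rewrite (Rabs_left1 (u - v)) by lra.
    assert (H1 := psi_increasing u v Huv). specialize (H u v Huv).
    rewrite Rabs_left1; lra.
  - rewrite (Rabs_right (u - v)) by lra.
    assert (H1 := psi_increasing v u ltac:(lra)). specialize (H v u ltac:(lra)).
    rewrite Rabs_right; lra.
Qed.

Lemma psi_level (y : R) : -1 < y < 1 -> exists v, -1 < v < 1 /\ psi v = y.
Proof.
  intros Hy.
  destruct (IVT_cor (fun v => psi v - y) (-1) 1) as [v [Hv Hz]].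
  - intros v. apply is_derive_continuity_pt with (psi1 v).
    apply is_derive_ext with (fun w => plus (psi w) (- y)); [easy|].
    rewrite <- (Rplus_0_r (psi1 v)).
    apply (is_derive_plus psi (fun _ => - y)); [apply psi_derive|].
    apply (is_derive_const (- y)).
  - lra.
  - rewrite psi_left, psi_right by lra. nra.
  - exists v. split; [|lra].
    split.
    + destruct (proj1 Hv) as [|Heq]; [easy|]. rewrite psi_left in Hz; lra.
    + destruct (proj2 Hv) as [|Heq]; [easy|]. rewrite psi_right in Hz; lra.
Qed.

Lemma psi1_lower_bound (lo hi : R) :
  -1 < lo <= hi -> hi < 1 ->
  exists kap, 0 < kap /\ forall v, lo <= v <= hi -> kap <= psi1 v.
Proof.
  intros Hlo Hhi.
  destruct (continuity_ab_min psi1 lo hi) as [m [Hm Hin]]; [lra| |].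
  { intros c _. apply continuity_pt_filterlim, psi1_continuous. }
  exists (psi1 m). split; [|easy].
  apply psi1_pos, Rabs_def1; lra.
Qed.

End Transition.

(** The interval [lo, hi] is the compact part of the layer used for sliding. The levels -1/2 and 1/2
    are chosen because [crit] lies in [0, 1/4] for x within 1/6 of 3, so both ends stay at least 1/4
    away from it in the [psi] coordinate. *)
Record profile (psi psi1 : R -> R) (L kap lo hi : R) : Prop := {
  pf_L : 0 < L;
  pf_kap : 0 < kap;
  pf_lo : -1 < lo;
  pf_lohi : lo < hi;
  pf_hi : hi < 1;
  pf_psi_lo : psi lo = - / 2;
  pf_psi_hi : psi hi = / 2;
  pf_derive : forall v, is_derive psi v (psi1 v);
  pf_mono : forall u v, u <= v -> psi u <= psi v;
  pf_lip : forall u v, Rabs (psi u - psi v) <= L * Rabs (u - v);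
  pf_slope : forall v, lo <= v <= hi -> kap <= psi1 v <= L;
  pf_right : forall v, 1 <= v -> psi v = 1;
  pf_left : forall v, v <= -1 -> psi v = -1
}.

Arguments pf_L {psi psi1 L kap lo hi} _.
Arguments pf_kap {psi psi1 L kap lo hi} _.
Arguments pf_lo {psi psi1 L kap lo hi} _.
Arguments pf_lohi {psi psi1 L kap lo hi} _.
Arguments pf_hi {psi psi1 L kap lo hi} _.
Arguments pf_psi_lo {psi psi1 L kap lo hi} _.
Arguments pf_psi_hi {psi psi1 L kap lo hi} _.
Arguments pf_derive {psi psi1 L kap lo hi} _.
Arguments pf_mono {psi psi1 L kap lo hi} _.
Arguments pf_lip {psi psi1 L kap lo hi} _.
Arguments pf_slope {psi psi1 L kap lo hi} _.
Arguments pf_right {psi psi1 L kap lo hi} _.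
Arguments pf_left {psi psi1 L kap lo hi} _.

Lemma transition_profile (psi : R -> R) :
  transition psi -> exists psi1 L kap lo hi, profile psi psi1 L kap lo hi.
Proof.
  intros (psi1 & psi2 & Hd & Hc & _ & _ & Hr & Hl & Hpos & _).
  destruct (psi1_bounded psi1 Hc Hpos) as [L [HL HbL]].
  destruct (psi_level psi psi1 Hd Hr Hl (- / 2)) as [lo [Hlo Elo]]; [lra|].
  destruct (psi_level psi psi1 Hd Hr Hl (/ 2)) as [hi [Hhi Ehi]]; [lra|].
  assert (Hmono := psi_increasing psi psi1 Hd Hr Hl Hpos).
  assert (Hlt : lo < hi).
  { destruct (Rle_lt_dec hi lo) as [H|]; [|easy].
    apply Hmono in H. lra. }
  destruct (psi1_lower_bound psi1 Hc Hpos lo hi) as [kap [Hk Hbk]]; [lra | lra |].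
  exists psi1, L, kap, lo, hi.
  constructor; try easy.
  - now apply (psi_lipschitz psi psi1).
  - intros v Hv. split; [now apply Hbk | apply HbL; lra].
Qed.

Section ProfileBounds.

Context (psi psi1 : R -> R) (L kap lo hi : R).
Context (P : profile psi psi1 L kap lo hi).

Lemma profile_range (v : R) : -1 <= psi v <= 1.
Proof.
  split.
  - destruct (Rle_lt_dec v (-1)) as [H|H].
    + rewrite (pf_left P) by easy. lra.
    + rewrite <- (pf_left P (-1)) by lra.
      apply (pf_mono P). lra.
  - destruct (Rle_lt_dec 1 v) as [H|H].
    + rewrite (pf_right P) by easy. lra.
    + rewrite <- (pf_right P 1) by lra.
      apply (pf_mono P). lra.
Qed.

Lemma profile_monotone_mult (u v : R) : 0 <= (psi u - psi v) * (u - v).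
Proof.
  destruct (Rle_lt_dec u v) as [H|H].
  - assert (H1 := pf_mono P u v H). nra.
  - assert (H1 := pf_mono P v u ltac:(lra)). nra.
Qed.

Lemma profile_coercive (u v : R) :
  lo <= u <= hi -> lo <= v <= hi ->
  kap * (u - v) ^ 2 <= (psi u - psi v) * (u - v).
Proof.
  assert (H : forall u v, lo <= u <= hi -> lo <= v <= hi -> u < v ->
    kap * (u - v) ^ 2 <= (psi u - psi v) * (u - v)).
  { clear u v. intros u v Hu Hv Huv.
    destruct (psi_mean_value psi psi1 (pf_derive P) u v Huv)
      as [c [Hc Hin]].
    destruct (pf_slope P c) as [Hk _]; [lra|].
    replace ((psi u - psi v) * (u - v)) with (psi1 c * (u - v) ^ 2)
      by (replace (psi u - psi v) with (- (psi v - psi u)) by ring;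
          rewrite Hc; ring).
    apply Rmult_le_compat_r; [apply pow2_ge_0 | easy]. }
  intros Hu Hv.
  destruct (Rtotal_order u v) as [Huv | [-> | Huv]].
  - now apply H.
  - lra.
  - specialize (H v u Hv Hu Huv).
    replace ((psi u - psi v) * (u - v)) with ((psi v - psi u) * (v - u)) by ring.
    replace ((u - v) ^ 2) with ((v - u) ^ 2) by ring. easy.
Qed.

(* If |u| > 3/2 both arguments lie on the same side of the layer, where psi is
   constant; otherwise 1 + u^2 <= 13/4. *)
Lemma profile_localized_lipschitz (u v : R) :
  Rabs (u - v) <= / 2 ->
  (psi u - psi v) * (u - v) <= 13 / 4 * L / (1 + u ^ 2) * (u - v) ^ 2.
Proof.
  intros Huv. apply Rabs_le_between in Huv.
  assert (HL := pf_L P).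
  assert (Hs := pow2_ge_0 (u - v)).
  assert (Hu0 := pow2_ge_0 u).
  assert (Hpos : 0 <= 13 / 4 * L / (1 + u ^ 2) * (u - v) ^ 2).
  { apply Rmult_le_pos; [|easy]. apply Rdiv_le_0_compat; lra. }
  destruct (Rle_lt_dec (3 / 2) u) as [H1|H1].
  { rewrite !(pf_right P) by lra. lra. }
  destruct (Rle_lt_dec u (- (3 / 2))) as [H2|H2].
  { rewrite !(pf_left P) by lra. lra. }
  apply Rle_trans with (L * (u - v) ^ 2).
  - eapply Rle_trans; [apply Rle_abs|].
    rewrite Rabs_mult.
    eapply Rle_trans.
    + apply Rmult_le_compat_r; [apply Rabs_pos|]. apply (pf_lip P).
    + rewrite Rmult_assoc, <- Rabs_mult, Rabs_right; [|apply Rle_ge, Rle_0_sqr].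
      right; ring.
  - apply Rmult_le_compat_r; [easy|].
    apply Rmult_le_reg_r with (1 + u ^ 2); [lra|].
    replace (13 / 4 * L / (1 + u ^ 2) * (1 + u ^ 2)) with (L * (13 / 4)) by (field; lra).
    apply Rmult_le_compat_l; [lra|]. nra.
Qed.

End ProfileBounds.

(** * Signs of the trigonometric coefficients *)

Lemma cos_ge_of_Rabs_le (t b : R) : Rabs t <= b -> b <= PI -> cos b <= cos t.
Proof.
  intros Ht Hb.
  assert (H0 := Rabs_pos t).
  assert (E : cos t = cos (Rabs t)).
  { unfold Rabs. destruct (Rcase_abs t); [now rewrite cos_neg | easy]. }
  rewrite E. apply cos_decr_1; lra.
Qed.

Lemma cos_PI_mul_nonneg (x : R) : - / 2 <= x <= / 2 -> 0 <= cos (PI * x).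
Proof.
  intros Hx. assert (HP := PI_RGT_0).
  apply cos_ge_0; nra.
Qed.

Lemma cos_PI_add_2 (x : R) : cos (PI * (x + 2)) = cos (PI * x).
Proof.
  replace (PI * (x + 2)) with (PI * x + 2 * PI) by ring.
  rewrite cos_plus, cos_2PI, sin_2PI. ring.
Qed.

Lemma cos_PI_sub_3 (x : R) : cos (PI * x) = - cos (PI * (x - 3)).
Proof.
  replace (PI * x) with (PI * ((x - 3 + 1) + 2)) by ring.
  rewrite cos_PI_add_2.
  replace (PI * (x - 3 + 1)) with (PI * (x - 3) + PI) by ring.
  apply neg_cos.
Qed.

Lemma sin_half_PI_add_2 (x : R) : sin (PI * (x + 2) / 2) = - sin (PI * x / 2).
Proof.
  replace (PI * (x + 2) / 2) with (PI * x / 2 + PI) by field.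
  apply neg_sin.
Qed.

Lemma sin_half_PI_sub_1 (x : R) : sin (PI * x / 2) = cos (PI / 2 * (x - 1)).
Proof.
  rewrite cos_sin. f_equal. lra.
Qed.

Lemma sin_half_PI_sub_3 (x : R) : sin (PI * x / 2) = - cos (PI / 2 * (x - 3)).
Proof.
  replace x with (x - 2 + 2) by ring.
  rewrite sin_half_PI_add_2, sin_half_PI_sub_1.
  f_equal. f_equal. ring.
Qed.

Lemma cos_PI_nonneg (x : R) :
  0 <= x <= / 2 \/ 3 / 2 <= x <= 5 / 2 \/ 7 / 2 <= x <= 4 -> 0 <= cos (PI * x).
Proof.
  intros [H | [H | H]].
  - apply cos_PI_mul_nonneg; lra.
  - replace x with (x - 2 + 2) by ring. rewrite cos_PI_add_2.
    apply cos_PI_mul_nonneg; lra.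
  - replace x with (x - 4 + 2 + 2) by ring. rewrite !cos_PI_add_2.
    apply cos_PI_mul_nonneg; lra.
Qed.

Lemma cos_PI_nonpos (x : R) : 5 / 2 <= x <= 7 / 2 -> cos (PI * x) <= 0.
Proof.
  intros H. rewrite cos_PI_sub_3.
  assert (0 <= cos (PI * (x - 3))) by (apply cos_PI_mul_nonneg; lra). lra.
Qed.

Lemma sin_half_PI_nonneg (x : R) : 0 <= x <= 2 -> 0 <= sin (PI * x / 2).
Proof.
  intros H. assert (HP := PI_RGT_0). apply sin_ge_0; nra.
Qed.

Lemma sin_half_PI_nonpos (x : R) : 2 <= x <= 4 -> sin (PI * x / 2) <= 0.
Proof.
  intros H. replace x with (x - 2 + 2) by ring. rewrite sin_half_PI_add_2.
  assert (0 <= sin (PI * (x - 2) / 2)) by (apply sin_half_PI_nonneg; lra). lra.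
Qed.

Lemma sin_half_PI_ge_half (x : R) : / 3 <= x <= 3 / 2 -> / 2 <= sin (PI * x / 2).
Proof.
  intros H. assert (HP := PI_RGT_0).
  rewrite sin_half_PI_sub_1.
  replace (/ 2) with (cos (PI / 3)) by (rewrite cos_PI3; lra).
  apply cos_ge_of_Rabs_le; [|lra].
  apply Rabs_le. nra.
Qed.

Lemma cos_PI6_ge : 4 / 5 <= cos (PI / 6).
Proof.
  rewrite cos_PI6.
  enough (8 / 5 <= sqrt 3) by lra.
  rewrite <- (sqrt_Rsqr (8 / 5)) by lra.
  apply sqrt_le_1_alt. unfold Rsqr. lra.
Qed.

(** The half-width 1/6 around x = 3 keeps both shifted angles within PI/6, whose cosine sqrt 3 / 2
    exceeds 4/5. *)
Lemma trig_sliding_window (x : R) :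
  17 / 6 <= x <= 19 / 6 ->
  -1 <= cos (PI * x) <= - (4 / 5) /\ -1 <= sin (PI * x / 2) <= - (4 / 5).
Proof.
  intros H. assert (HP := PI_RGT_0). assert (Hc := cos_PI6_ge).
  assert (H1 : cos (PI / 6) <= cos (PI * (x - 3))).
  { apply cos_ge_of_Rabs_le; [apply Rabs_le; nra | lra]. }
  assert (H2 : cos (PI / 6) <= cos (PI / 2 * (x - 3))).
  { apply cos_ge_of_Rabs_le; [apply Rabs_le; nra | lra]. }
  split.
  - split; [apply COS_bound|]. rewrite cos_PI_sub_3. lra.
  - split; [apply SIN_bound|]. rewrite sin_half_PI_sub_3. lra.
Qed.

Lemma crit_sliding_window (x : R) : 17 / 6 <= x <= 19 / 6 -> 0 <= crit x <= / 4.
Proof.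
  intros H. destruct (trig_sliding_window x H) as [Hc _].
  unfold crit.
  assert (E : / - cos (PI * x) = - / cos (PI * x)) by (field; lra).
  assert (H1 : / 1 <= / - cos (PI * x)) by (apply Rinv_le_contravar; lra).
  assert (H2 : / - cos (PI * x) <= / (4 / 5)) by (apply Rinv_le_contravar; lra).
  rewrite Rinv_1 in H1. replace (/ (4 / 5)) with (5 / 4) in H2 by lra. lra.
Qed.

Lemma crit_derive_sliding_window (x : R) :
  17 / 6 <= x <= 19 / 6 ->
  exists l, is_derive crit x l /\ Rabs l <= 8.
Proof.
  intros H. destruct (trig_sliding_window x H) as [Hc _].
  exists (- (sin (PI * x) * PI) / (cos (PI * x)) ^ 2). split.
  - unfold crit. auto_derive; [lra | field; lra].
  - assert (HP := PI_RGT_0). assert (HP4 := PI_4).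
    assert (Hs := SIN_bound (PI * x)).
    assert (Hc2 : 16 / 25 <= cos (PI * x) ^ 2) by nra.
    unfold Rdiv. rewrite Rabs_mult, Rabs_Ropp, Rabs_inv.
    rewrite (Rabs_right (cos (PI * x) ^ 2)) by lra.
    rewrite Rabs_mult, (Rabs_right PI) by lra.
    apply Rmult_le_reg_r with (cos (PI * x) ^ 2); [lra|].
    rewrite Rmult_assoc, Rinv_l by lra.
    assert (Rabs (sin (PI * x)) <= 1) by (apply Rabs_le; lra).
    nra.
Qed.

(** * Solutions and their return map *)

Section Dynamics.

Context (psi psi1 : R -> R) (L kap lo hi a eps : R).
Context (P : profile psi psi1 L kap lo hi).
Context (a_ge : 600 <= a).
Context (eps_gt0 : 0 < eps).
Context (inv_eps_ge : 100 * a <= / eps).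

Let N : R := / eps.
Let sol (u : R -> R) : Prop := is_solution psi a eps u (fun x => 0 <= x <= 4).

(** * A priori bounds for a single solution over one period *)

Lemma scale_pos : 0 < N / a.
Proof. apply Rdiv_lt_0_compat; [apply Rinv_0_lt_compat|]; lra. Qed.

Lemma scale_ge : 100 <= N / a.
Proof.
  apply Rmult_le_reg_r with a; [lra|].
  unfold Rdiv. rewrite Rmult_assoc, Rinv_l by lra. unfold N. lra.
Qed.

Lemma scale_mul : N / a * a = N.
Proof. field; lra. Qed.

Lemma field_eq (x v : R) :
  F psi a eps x v =
    - a * v - N * ((1 + (1 + psi v) * cos (PI * x)) * sin (PI * x / 2)).
Proof. unfold F, N. field. lra. Qed.

Lemma field_bound (x v : R) : Rabs (F psi a eps x v + a * v) <= 3 * N.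
Proof.
  assert (Hp := profile_range _ _ _ _ _ _ P v).
  assert (Hc := COS_bound (PI * x)). assert (Hs := SIN_bound (PI * x / 2)).
  assert (HN : 0 < N) by (apply Rinv_0_lt_compat; lra).
  replace (F psi a eps x v + a * v) with
    (- ((1 + (1 + psi v) * cos (PI * x)) * sin (PI * x / 2)) * N)
    by (unfold F, N; field; lra).
  rewrite Rabs_mult, (Rabs_right N) by lra.
  apply Rmult_le_compat_r; [lra|].
  rewrite Rabs_Ropp, Rabs_mult.
  assert (Rabs (1 + (1 + psi v) * cos (PI * x)) <= 3) by (apply Rabs_le; nra).
  assert (Rabs (sin (PI * x / 2)) <= 1) by (apply Rabs_le; lra).
  assert (H1 := Rabs_pos (1 + (1 + psi v) * cos (PI * x))).
  assert (H2 := Rabs_pos (sin (PI * x / 2))).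
  nra.
Qed.

(** By [field_bound], both u and -u satisfy f' <= -a f + 3N, whose equilibrium is 3N/a; levels from
    there on cannot be exceeded. *)
Lemma solution_bounded (u : R -> R) (c : R) :
  sol u -> 3 * (N / a) <= c -> Rabs (u 0) <= c ->
  forall x, 0 <= x <= 4 -> Rabs (u x) <= c.
Proof.
  intros Hu Hc H0 x Hx. apply Rabs_le_between in H0.
  assert (HE : 0 < exp (- a * (x - 0))) by apply exp_pos.
  assert (HE1 : exp (- a * (x - 0)) <= 1) by (rewrite <- exp_0; apply exp_le; nra).
  assert (Hb : forall y, - (3 * N) <= F psi a eps y (u y) + a * u y <= 3 * N).
  { intros y. apply Rabs_le_between, field_bound. }
  assert (E : 3 * N / a = 3 * (N / a)) by (field; lra).
  apply Rabs_le_between. split.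
  - assert (H := gronwall_affine (fun y => - u y) (fun y => - F psi a eps y (u y))
      a (3 * N) 0 x ltac:(lra) ltac:(lra)).
    cbv beta in H. rewrite E in H.
    enough (- u x <= 3 * (N / a) + (- u 0 - 3 * (N / a)) * exp (- a * (x - 0))) by nra.
    apply H; intros y Hy.
    + apply (is_derive_opp u). apply Hu; lra.
    + specialize (Hb y). lra.
  - assert (H := gronwall_affine u (fun y => F psi a eps y (u y))
      a (3 * N) 0 x ltac:(lra) ltac:(lra)).
    rewrite E in H.
    enough (u x <= 3 * (N / a) + (u 0 - 3 * (N / a)) * exp (- a * (x - 0))) by nra.
    apply H; intros y Hy.
    + apply Hu; lra.
    + specialize (Hb y). lra.
Qed.

(** On [1/3, 1/2] one has u' <= -a u - N/2, and time 1/6 suffices to come from 4N/a close to the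
    equilibrium -N/(2a). Afterwards -N/(4a) is a barrier: this level is at most -25, so [psi] is -1
    there, the cosine term drops out and u' = N/4 - N sin(pi x / 2) < 0. *)
Lemma solution_below_layer (u : R -> R) :
  sol u -> Rabs (u 0) <= 4 * (N / a) ->
  forall x, / 2 <= x <= 3 / 2 -> u x <= - (N / a / 4).
Proof.
  intros Hu H0.
  assert (Hs := scale_pos). assert (Hs1 := scale_ge). assert (Hm := scale_mul).
  assert (H3 : u (/ 3) <= 4 * (N / a)).
  { apply (Rabs_le_between (u (/ 3)) (4 * (N / a))).
    apply solution_bounded; [easy | lra | easy | lra]. }
  assert (H2 : u (/ 2) <= - (N / a / 4)).
  { assert (H := gronwall_affine u (fun y => F psi a eps y (u y))
      a (- (N / 2)) (/ 3) (/ 2) ltac:(lra) ltac:(lra)).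
    assert (He : exp (- a * (/ 2 - / 3)) <= / 101).
    { replace (- a * (/ 2 - / 3)) with (- (a / 6)) by field.
      eapply Rle_trans; [apply exp_neg_le_inv; lra|].
      apply Rinv_le_contravar; lra. }
    assert (HE : 0 < exp (- a * (/ 2 - / 3))) by apply exp_pos.
    replace (- (N / 2) / a) with (- (N / a / 2)) in H by (field; lra).
    eapply Rle_trans; [apply H|].
    - intros y Hy. apply Hu; lra.
    - intros y Hy.
      assert (Hsin := sin_half_PI_ge_half y ltac:(lra)).
      assert (Hcos := cos_PI_nonneg y ltac:(left; lra)).
      assert (Hp := profile_range _ _ _ _ _ _ P (u y)).
      assert (HN : 0 < N) by (apply Rinv_0_lt_compat; lra).
      rewrite field_eq.
      assert (0 <= (1 + psi (u y)) * cos (PI * y)) by (apply Rmult_le_pos; lra).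
      assert (/ 2 <= (1 + (1 + psi (u y)) * cos (PI * y)) * sin (PI * y / 2)) by nra.
      assert (/ 2 * N <= (1 + (1 + psi (u y)) * cos (PI * y)) * sin (PI * y / 2) * N)
        by (apply Rmult_le_compat_r; lra).
      lra.
    - nra. }
  apply (upper_barrier u (fun y => F psi a eps y (u y)) _ (/ 2) (3 / 2)); [| |easy].
  - intros y Hy. apply Hu; lra.
  - intros y Hy Ey.
    assert (Hsin := sin_half_PI_ge_half y ltac:(lra)).
    assert (HN : 0 < N) by (apply Rinv_0_lt_compat; lra).
    rewrite field_eq, Ey, (pf_left P) by lra.
    replace (- a * - (N / a / 4)) with (N / 4) by (field; lra).
    replace (1 + (1 + -1) * cos (PI * y)) with 1 by ring.
    assert (/ 2 * N <= sin (PI * y / 2) * N) by (apply Rmult_le_compat_r; lra).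
    lra.
Qed.

(** [crit] is the zero of the bracket 1 + (1 + psi) cos(pi x) in the [psi] coordinate, so factoring
    out the cosine leaves [psi v - crit x]. *)
Lemma field_sliding_form (x v : R) :
  17 / 6 <= x <= 19 / 6 ->
  F psi a eps x v =
    - a * v - N * (cos (PI * x) * sin (PI * x / 2)) * (psi v - crit x).
Proof.
  intros Hx. destruct (trig_sliding_window x Hx) as [Hc _].
  unfold F, crit, N. field. lra.
Qed.

Lemma sliding_divergence (x : R) :
  17 / 6 <= x <= 19 / 6 ->
  / 2 <= cos (PI * x) * sin (PI * x / 2) <= 1.
Proof.
  intros Hx. destruct (trig_sliding_window x Hx) as [Hc Hs]. nra.
Qed.

(** Here [psi v] exceeds [crit x] by at least 1/4 and cos times sin is at least 1/2, whence N/8. *)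
Lemma field_above_window (x v : R) :
  17 / 6 <= x <= 19 / 6 -> hi <= v -> F psi a eps x v <= - a * v - N / 8.
Proof.
  intros Hx Hv. rewrite field_sliding_form by easy.
  assert (Hd := sliding_divergence x Hx). assert (Hc := crit_sliding_window x Hx).
  assert (Hp := pf_mono P _ _ Hv). rewrite (pf_psi_hi P) in Hp.
  assert (HN : 0 < N) by (apply Rinv_0_lt_compat; lra).
  assert (/ 8 <= cos (PI * x) * sin (PI * x / 2) * (psi v - crit x)) by nra.
  nra.
Qed.

Lemma field_below_window (x v : R) :
  17 / 6 <= x <= 19 / 6 -> v <= lo -> - a * v + N / 8 <= F psi a eps x v.
Proof.
  intros Hx Hv. rewrite field_sliding_form by easy.
  assert (Hd := sliding_divergence x Hx). assert (Hc := crit_sliding_window x Hx).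
  assert (Hp := pf_mono P _ _ Hv). rewrite (pf_psi_lo P) in Hp.
  assert (HN : 0 < N) by (apply Rinv_0_lt_compat; lra).
  assert (/ 8 <= cos (PI * x) * sin (PI * x / 2) * (crit x - psi v)) by nra.
  nra.
Qed.

(** By the barriers at lo and hi, a solution outside [lo, hi] at time x has been on that same side
    since 17/6. The strong drift N/8 then acted for at least 1/12, so u would have been driven from
    within 4N/a to far beyond the opposite side of the layer. *)
Lemma solution_in_window (u : R -> R) :
  sol u -> Rabs (u 0) <= 4 * (N / a) ->
  forall x, 35 / 12 <= x <= 19 / 6 -> lo <= u x <= hi.
Proof.
  intros Hu H0 x Hx.
  assert (Hs := scale_ge). assert (Hm := scale_mul).
  assert (Hlo := pf_lo P). assert (Hlh := pf_lohi P). assert (Hhi := pf_hi P).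
  assert (H3 : - (4 * (N / a)) <= u (17 / 6) <= 4 * (N / a)).
  { apply Rabs_le_between. apply solution_bounded; [easy | lra | easy | lra]. }
  assert (He : exp (- a * (x - 17 / 6)) <= / 51).
  { apply Rle_trans with (exp (- (a / 12))); [apply exp_le; nra|].
    eapply Rle_trans; [apply exp_neg_le_inv; lra|].
    apply Rinv_le_contravar; lra. }
  assert (HE : 0 < exp (- a * (x - 17 / 6))) by apply exp_pos.
  assert (E : - (N / 8) / a = - (N / a / 8)) by (field; lra).
  split.
  - destruct (Rle_lt_dec lo (u x)) as [|Hlt]; [easy|exfalso].
    assert (Hall : forall y, 17 / 6 <= y <= x -> u y < lo).
    { intros y Hy. destruct (Rle_lt_dec lo (u y)) as [Hge|]; [exfalso|easy].
      assert (lo <= u x); [|lra].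
      apply (lower_barrier u (fun y => F psi a eps y (u y)) lo y x); [| |easy|lra].
      - intros t Ht. apply Hu; lra.
      - intros t Ht Et. rewrite Et.
        assert (Hf := field_below_window t lo ltac:(lra) ltac:(lra)). nra. }
    assert (H := gronwall_affine (fun y => - u y) (fun y => - F psi a eps y (u y))
      a (- (N / 8)) (17 / 6) x ltac:(lra) ltac:(lra)).
    cbv beta in H. rewrite E in H.
    assert (- u x <= - (N / a / 8)
      + (- u (17 / 6) - - (N / a / 8)) * exp (- a * (x - 17 / 6))); [|nra].
    apply H; intros y Hy.
    + apply (is_derive_opp u). apply Hu; lra.
    + assert (Hf := field_below_window y (u y) ltac:(lra)). specialize (Hall y Hy). lra.
  - destruct (Rle_lt_dec (u x) hi) as [|Hlt]; [easy|exfalso].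
    assert (Hall : forall y, 17 / 6 <= y <= x -> hi < u y).
    { intros y Hy. destruct (Rle_lt_dec (u y) hi) as [Hge|]; [exfalso|easy].
      assert (u x <= hi); [|lra].
      apply (upper_barrier u (fun y => F psi a eps y (u y)) hi y x); [| |easy|lra].
      - intros t Ht. apply Hu; lra.
      - intros t Ht Et. rewrite Et.
        assert (Hf := field_above_window t hi ltac:(lra) ltac:(lra)). nra. }
    assert (H := gronwall_affine u (fun y => F psi a eps y (u y))
      a (- (N / 8)) (17 / 6) x ltac:(lra) ltac:(lra)).
    rewrite E in H.
    assert (u x <= - (N / a / 8)
      + (u (17 / 6) - - (N / a / 8)) * exp (- a * (x - 17 / 6))); [|nra].
    apply H; intros y Hy.
    + apply Hu; lra.
    + assert (Hf := field_above_window y (u y) ltac:(lra)). specialize (Hall y Hy). lra.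
Qed.


(* On the window z := psi u - crit solves z' = - psi'(u) m z / eps + O(1) with
   psi'(u) m bounded below, so z becomes O(eps) after a time of order one. *)
Lemma solution_near_crit (u : R -> R) :
  sol u -> Rabs (u 0) <= 4 * (N / a) ->
  forall x, 3 <= x <= 19 / 6 ->
    Rabs (psi (u x) - crit x) <= (2 * (a * L + 8) + 48) / kap * eps.
Proof.
  intros Hu H0 x Hx.
  assert (Hlo := pf_lo P). assert (Hhi := pf_hi P).
  assert (Hk := pf_kap P). assert (HL := pf_L P).
  assert (HN : 0 < N) by (apply Rinv_0_lt_compat; lra).
  set (D := a * L + 8). set (lam := kap * N).
  assert (HD : 0 < D) by (unfold D; nra).
  assert (Hlam : 0 < lam) by (unfold lam; nra).
  set (z y := psi (u y) - crit y).
  set (dz y := F psi a eps y (u y) * psi1 (u y) - Derive crit y).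
  assert (Hz : forall y, 35 / 12 <= y <= x -> is_derive z y (dz y)).
  { intros y Hy. apply (is_derive_minus (fun y => psi (u y)) crit).
    - apply (is_derive_comp psi u); [apply (pf_derive P) | apply Hu; lra].
    - destruct (crit_derive_sliding_window y ltac:(lra)) as [l [Hl _]].
      apply Derive_correct. now exists l. }
  (* [D] bounds the drift a u psi'(u) + crit'. Young's inequality spends half of the dissipation lam
     z^2 on the cross term 2 D |z|, leaving the rate lam/2 and the source 2 D^2 / lam. *)
  assert (H := gronwall_affine (fun y => z y ^ 2) (fun y => 2 * z y * dz y)
    (lam / 2) (2 * D ^ 2 / lam) (35 / 12) x ltac:(lra) ltac:(lra)).
  cbv beta in H.
  assert (Hzx : z x ^ 2 <= ((2 * D + 48) / lam) ^ 2).
  { assert (Hz0 : z (35 / 12) ^ 2 <= 1).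
    { assert (Hw := solution_in_window u Hu H0 (35 / 12) ltac:(lra)).
      assert (Hc := crit_sliding_window (35 / 12) ltac:(lra)).
      assert (H1 := pf_mono P _ _ (proj1 Hw)). assert (H2 := pf_mono P _ _ (proj2 Hw)).
      rewrite (pf_psi_lo P) in H1. rewrite (pf_psi_hi P) in H2.
      unfold z. nra. }
    (* At least 1/12 has elapsed, so the exponent is at most -lam/24. Each of two factors
       exp(-lam/48) is at most 48/lam, and 2304 = 48^2; decay like lam^-2 suffices for z^2 =
       O(eps^2). *)
    assert (He : exp (- (lam / 2) * (x - 35 / 12)) <= 2304 / lam ^ 2).
    { apply Rle_trans with (exp (- (lam / 48)) * exp (- (lam / 48))).
      - rewrite <- exp_plus. apply exp_le. nra.
      - assert (H1 := exp_neg_le_inv (lam / 48) ltac:(lra)).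
        assert (H2 : / (1 + lam / 48) <= / (lam / 48)) by (apply Rinv_le_contravar; lra).
        assert (H3 := exp_pos (- (lam / 48))).
        replace (2304 / lam ^ 2) with (/ (lam / 48) * / (lam / 48)) by (field; lra).
        apply Rmult_le_compat; lra. }
    assert (HE : 0 < exp (- (lam / 2) * (x - 35 / 12))) by apply exp_pos.
    assert (Eb : 2 * D ^ 2 / lam / (lam / 2) = 4 * D ^ 2 / lam ^ 2) by (field; lra).
    rewrite Eb in H.
    assert (Hb : 0 < 4 * D ^ 2 / lam ^ 2) by (apply Rdiv_lt_0_compat; nra).
    apply Rle_trans with (4 * D ^ 2 / lam ^ 2 + 2304 / lam ^ 2).
    - eapply Rle_trans; [apply H|nra].
      + intros y Hy. specialize (Hz y Hy).
        auto_derive; [now exists (dz y)|].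
        replace (Derive (fun x0 => z x0) y) with (dz y)
          by (symmetry; now apply is_derive_unique).
        ring.
      + intros y Hy.
        assert (Hw := solution_in_window u Hu H0 y ltac:(lra)).
        assert (Hm := sliding_divergence y ltac:(lra)).
        assert (Hsl := pf_slope P (u y) Hw).
        destruct (crit_derive_sliding_window y ltac:(lra)) as [l [Hl Hl8]].
        unfold dz. rewrite (is_derive_unique _ _ _ Hl), field_sliding_form by lra.
        fold (z y).
        set (m := cos (PI * y) * sin (PI * y / 2)) in *.
        assert (Hr : Rabs (a * u y * psi1 (u y) + l) <= D).
        { eapply Rle_trans; [apply Rabs_triang|]. unfold D.
          apply Rplus_le_compat; [|easy].
          rewrite !Rabs_mult, (Rabs_right a), (Rabs_right (psi1 (u y))), Rmult_assoc
            by lra.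
          apply Rmult_le_compat_l; [lra|].
          assert (Rabs (u y) <= 1) by (apply Rabs_le; lra).
          assert (H5 := Rabs_pos (u y)). nra. }
        assert (Hzr : - z y * (a * u y * psi1 (u y) + l) <= Rabs (z y) * D).
        { eapply Rle_trans; [apply Rle_abs|]. rewrite Rabs_mult, Rabs_Ropp.
          apply Rmult_le_compat_l; [apply Rabs_pos | easy]. }
        assert (Hyoung : 2 * (Rabs (z y) * D) <= lam / 2 * z y ^ 2 + 2 * D ^ 2 / lam).
        { rewrite <- (pow2_abs (z y)).
          apply Rmult_le_reg_r with (2 * lam); [lra|].
          replace ((lam / 2 * Rabs (z y) ^ 2 + 2 * D ^ 2 / lam) * (2 * lam)) with
            (lam ^ 2 * Rabs (z y) ^ 2 + 4 * D ^ 2) by (field; lra).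
          assert (H1 := pow2_ge_0 (lam * Rabs (z y) - 2 * D)). nra. }
        assert (Hdiss : lam * / 2 * z y ^ 2 <= N * psi1 (u y) * m * z y ^ 2).
        { apply Rmult_le_compat_r; [apply pow2_ge_0|].
          apply Rmult_le_compat; unfold lam; nra. }
        replace (2 * z y * ((- a * u y - N * m * z y) * psi1 (u y) - l)) with
          (2 * (- z y * (a * u y * psi1 (u y) + l))
            - 2 * (N * psi1 (u y) * m * z y ^ 2)) by ring.
        lra.
    - replace (4 * D ^ 2 / lam ^ 2 + 2304 / lam ^ 2) with
        ((4 * D ^ 2 + 2304) * / lam ^ 2) by (field; lra).
      replace (((2 * D + 48) / lam) ^ 2) with ((2 * D + 48) ^ 2 * / lam ^ 2)
        by (field; lra).
      apply Rmult_le_compat_r; [left; apply Rinv_0_lt_compat; nra | nra]. }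
  replace ((2 * D + 48) / kap * eps) with ((2 * D + 48) / lam)
    by (unfold lam, N; field; lra).
  apply Rabs_le_of_sqr_le; [|exact Hzx].
  apply Rdiv_le_0_compat; lra.
Qed.

(** * Growth and contraction of the difference of two solutions *)

Section Comparison.

Context (u1 u2 : R -> R) (sol1 : sol u1) (sol2 : sol u2).

Let w (x : R) : R := u1 x - u2 x.
Let jump (x : R) : R := (psi (u1 x) - psi (u2 x)) * w x.
Let m (x : R) : R := cos (PI * x) * sin (PI * x / 2).

Lemma sqr_difference_derive (x : R) :
  0 <= x <= 4 ->
  is_derive (fun y => w y ^ 2) x (2 * (- a * w x ^ 2 - N * m x * jump x)).
Proof.
  intros Hx.
  assert (Hw : is_derive w x (F psi a eps x (u1 x) - F psi a eps x (u2 x))).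
  { apply (is_derive_minus u1 u2); [now apply sol1 | now apply sol2]. }
  auto_derive; [eexists; exact Hw|].
  replace (Derive (fun x0 => w x0) x) with
    (F psi a eps x (u1 x) - F psi a eps x (u2 x))
    by (symmetry; now apply is_derive_unique).
  rewrite !field_eq. unfold jump, m, w. ring.
Qed.

Lemma jump_nonneg (x : R) : 0 <= jump x.
Proof. apply (profile_monotone_mult _ _ _ _ _ _ P). Qed.

Lemma jump_le (x : R) : jump x <= L * w x ^ 2.
Proof.
  unfold jump. eapply Rle_trans; [apply Rle_abs|]. rewrite Rabs_mult.
  eapply Rle_trans.
  - apply Rmult_le_compat_r; [apply Rabs_pos|]. apply (pf_lip P).
  - unfold w. rewrite <- (pow2_abs (u1 x - u2 x)). right; ring.
Qed.

Lemma divergence_bounds (x : R) : -1 <= m x <= 1.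
Proof.
  assert (Hc := COS_bound (PI * x)). assert (Hs := SIN_bound (PI * x / 2)).
  unfold m. nra.
Qed.

Lemma sqr_difference_growth (x : R) :
  0 <= x <= 4 -> w x ^ 2 <= w 0 ^ 2 * exp (2 * N * L * x).
Proof.
  intros Hx.
  assert (HN : 0 < N) by (apply Rinv_0_lt_compat; lra).
  assert (H := gronwall (fun y => w y ^ 2)
    (fun y => 2 * (- a * w y ^ 2 - N * m y * jump y)) (2 * N * L) 0 x ltac:(lra)).
  cbv beta in H. rewrite Rminus_0_r in H. apply H; intros y Hy.
  - apply sqr_difference_derive; lra.
  - assert (H1 := jump_nonneg y). assert (H2 := jump_le y).
    assert (H3 := divergence_bounds y). assert (H4 := pow2_ge_0 (w y)).
    assert (- m y * jump y <= L * w y ^ 2) by nra.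
    assert (N * (- m y * jump y) <= N * (L * w y ^ 2))
      by (apply Rmult_le_compat_l; lra).
    nra.
Qed.

(** Exponentially large in 1/eps, hence useless for contraction; it serves for uniqueness, for
    continuity of the return map and for keeping nearby solutions within 1/2 of each other. *)
Lemma difference_growth (x : R) :
  0 <= x <= 4 -> Rabs (w x) <= Rabs (w 0) * exp (4 * N * L).
Proof.
  intros Hx.
  assert (HN : 0 < N) by (apply Rinv_0_lt_compat; lra).
  assert (HL := pf_L P).
  assert (He := exp_pos (4 * N * L)).
  apply Rabs_le_of_sqr_le.
  - apply Rmult_le_pos; [apply Rabs_pos | lra].
  - rewrite Rpow_mult_distr, pow2_abs.
    eapply Rle_trans; [now apply sqr_difference_growth|].
    apply Rmult_le_compat_l; [apply pow2_ge_0|].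
    replace (exp (4 * N * L) ^ 2) with (exp (4 * N * L) * exp (4 * N * L)) by ring.
    rewrite <- exp_plus. apply exp_le.
    assert (0 <= N * L) by (apply Rmult_le_pos; lra). nra.
Qed.

Lemma sqr_difference_nonincreasing (p q : R) :
  0 <= p <= q -> q <= 4 ->
  (forall x, p <= x <= q -> 0 <= m x * jump x) ->
  w q ^ 2 <= w p ^ 2.
Proof.
  intros Hp Hq Hm.
  assert (HN : 0 < N) by (apply Rinv_0_lt_compat; lra).
  apply (nonincreasing_of_derive (fun y => w y ^ 2)
    (fun y => 2 * (- a * w y ^ 2 - N * m y * jump y))); [lra | |]; intros y Hy.
  - apply sqr_difference_derive; lra.
  - specialize (Hm y Hy). assert (H4 := pow2_ge_0 (w y)).
    assert (0 <= N * (m y * jump y)) by (apply Rmult_le_pos; lra). nra.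
Qed.

(** The factor 2 from differentiating the square compensates m >= 1/2, so the rate is kap N during a
    time 1/6. *)
Lemma sqr_difference_sliding :
  Rabs (u1 0) <= 4 * (N / a) -> Rabs (u2 0) <= 4 * (N / a) ->
  w (19 / 6) ^ 2 <= w 3 ^ 2 * exp (- (kap * N) / 6).
Proof.
  intros H1 H2.
  assert (HN : 0 < N) by (apply Rinv_0_lt_compat; lra).
  assert (Hk := pf_kap P).
  assert (H := gronwall (fun y => w y ^ 2)
    (fun y => 2 * (- a * w y ^ 2 - N * m y * jump y)) (- (kap * N)) 3 (19 / 6)
    ltac:(lra)).
  cbv beta in H.
  replace (- (kap * N) / 6) with (- (kap * N) * (19 / 6 - 3)) by field.
  apply H; intros y Hy.
  - apply sqr_difference_derive; lra.
  - assert (Hm := sliding_divergence y ltac:(lra)). fold (m y) in Hm.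
    assert (Hj := profile_coercive _ _ _ _ _ _ P (u1 y) (u2 y)
      (solution_in_window u1 sol1 H1 y ltac:(lra))
      (solution_in_window u2 sol2 H2 y ltac:(lra))).
    fold (w y) in Hj. fold (jump y) in Hj.
    assert (H4 := pow2_ge_0 (w y)).
    assert (0 <= kap * w y ^ 2) by (apply Rmult_le_pos; lra).
    assert (/ 2 * (kap * w y ^ 2) <= m y * jump y) by (apply Rmult_le_compat; lra).
    assert (N * (/ 2 * (kap * w y ^ 2)) <= N * (m y * jump y))
      by (apply Rmult_le_compat_l; lra).
    nra.
Qed.

(* Where m <= 0 nearby solutions separate inside the layer, but there they also
   move upwards at speed comparable with |m| / eps: the weight exp (-2k atan u1)
   absorbs the expansion, at a cost independent of eps. *)
Lemma sqr_difference_crossing (p q : R) :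
  2 <= p <= q -> q <= 4 -> q - p <= / 2 ->
  (forall x, p <= x <= q -> 0 <= cos (PI * x) /\ Rabs (w x) <= / 2) ->
  w q ^ 2 <= w p ^ 2 * exp (26 * L + 13 / 8 * L * a).
Proof.
  intros Hp Hq Hpq Hx.
  assert (HN : 0 < N) by (apply Rinv_0_lt_compat; lra).
  assert (HL := pf_L P).
  (* With the constant of [profile_localized_lipschitz], the decay of the weight cancels the
     expansion of w^2 exactly; only the effect of the damping on the weight, of rate k a,
     survives. *)
  set (k := 13 / 4 * L).
  set (dw y := 2 * (- a * w y ^ 2 - N * m y * jump y)).
  set (dE y := (dw y - 2 * k * (F psi a eps y (u1 y) / (1 + u1 y ^ 2)) * w y ^ 2)
    * exp (- (2 * k) * atan (u1 y))).
  assert (H := gronwall (fun y => w y ^ 2 * exp (- (2 * k) * atan (u1 y))) dE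
    (k * a) p q ltac:(lra)).
  cbv beta in H.
  assert (HE : w q ^ 2 * exp (- (2 * k) * atan (u1 q)) <=
    w p ^ 2 * exp (- (2 * k) * atan (u1 p)) * exp (k * a * (q - p))).
  { apply H; intros y Hy.
    - assert (Hd := sqr_difference_derive y ltac:(lra)). fold (dw y) in Hd.
      assert (He : is_derive (fun t => exp (- (2 * k) * atan (u1 t))) y
        (- (2 * k) * (F psi a eps y (u1 y) / (1 + u1 y ^ 2))
          * exp (- (2 * k) * atan (u1 y)))).
      { assert (Hu := sol1 y ltac:(lra)).
        auto_derive; [now eexists; apply Hu|].
        replace (Derive (fun x0 => u1 x0) y) with (F psi a eps y (u1 y))
          by (symmetry; now apply is_derive_unique).
        field. assert (H1 := pow2_ge_0 (u1 y)). nra. }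
      replace (dE y) with (dw y * exp (- (2 * k) * atan (u1 y)) + w y ^ 2 *
        (- (2 * k) * (F psi a eps y (u1 y) / (1 + u1 y ^ 2))
          * exp (- (2 * k) * atan (u1 y)))) by (unfold dE; ring).
      apply (is_derive_mult (fun t => w t ^ 2)
        (fun t => exp (- (2 * k) * atan (u1 t)))); [easy | easy |].
      intros s t. apply Rmult_comm.
    - destruct (Hx y Hy) as [Hcos Hw].
      assert (Hsin := sin_half_PI_nonpos y ltac:(lra)).
      assert (Hcos1 := COS_bound (PI * y)).
      assert (Hu2 := pow2_ge_0 (u1 y)). assert (Hw2 := pow2_ge_0 (w y)).
      assert (Hj0 := jump_nonneg y).
      assert (Hj : jump y <= k / (1 + u1 y ^ 2) * w y ^ 2)
        by now apply (profile_localized_lipschitz _ _ _ _ _ _ P).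
      set (s := - sin (PI * y / 2)).
      set (r := / (1 + u1 y ^ 2)) in *.
      assert (Hr : 0 < r) by (apply Rinv_0_lt_compat; lra).
      (* Although u1 may be of order N/a, the damping -a u1 changes atan u1 at a rate of at most
         a/2. *)
      assert (Hru : - / 2 <= u1 y * r <= / 2).
      { split; apply Rmult_le_reg_r with (1 + u1 y ^ 2); try lra;
          unfold r; rewrite Rmult_assoc, Rinv_l by lra.
        - assert (H1 := pow2_ge_0 (u1 y + 1)). nra.
        - assert (H1 := pow2_ge_0 (u1 y - 1)). nra. }
      assert (Hs : 0 <= s) by (unfold s; lra).
      assert (Hk : 0 < k) by (unfold k; lra).
      assert (Hmj : - m y * jump y <= s * (k * r * w y ^ 2)).
      { replace (- m y * jump y) with (s * (cos (PI * y) * jump y))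
          by (unfold m, s; ring).
        apply Rmult_le_compat_l; [easy|]. unfold Rdiv in Hj. fold r in Hj. nra. }
      (* As cos >= 0 and psi >= -1, the bracket in the field is at least 1, so the upward push is at
         least N s. *)
      assert (HF : N * s * r - a / 2 <= F psi a eps y (u1 y) * r).
      { rewrite field_eq.
        assert (Hpr := profile_range _ _ _ _ _ _ P (u1 y)).
        assert (Hg : s <= - ((1 + (1 + psi (u1 y)) * cos (PI * y)) * sin (PI * y / 2))).
        { assert (0 <= (1 + psi (u1 y)) * cos (PI * y)) by (apply Rmult_le_pos; lra).
          unfold s. nra. }
        assert (N * r * s <= N * r *
          - ((1 + (1 + psi (u1 y)) * cos (PI * y)) * sin (PI * y / 2))).
        { apply Rmult_le_compat_l; [|easy]. apply Rmult_le_pos; lra. }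
        assert (a * (u1 y * r) <= a * / 2) by (apply Rmult_le_compat_l; lra).
        lra. }
      unfold dE. rewrite <- Rmult_assoc.
      apply Rmult_le_compat_r; [left; apply exp_pos|].
      unfold dw, Rdiv. fold r.
      assert (Hkw : 0 <= k * w y ^ 2) by (apply Rmult_le_pos; lra).
      assert (G1 : N * (- m y * jump y) <= N * (s * (k * r * w y ^ 2)))
        by (apply Rmult_le_compat_l; lra).
      assert (G2 : k * w y ^ 2 * (N * s * r - a / 2) <=
        k * w y ^ 2 * (F psi a eps y (u1 y) * r)) by (apply Rmult_le_compat_l; lra).
      assert (0 <= a * w y ^ 2) by (apply Rmult_le_pos; lra).
      lra. }
  assert (HP4 := PI_4).
  assert (Hq1 := atan_bound (u1 q)). assert (Hp1 := atan_bound (u1 p)).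
  assert (Hk : 0 < k) by (unfold k; lra).
  apply Rmult_le_reg_r with (exp (- (2 * k) * atan (u1 q))); [apply exp_pos|].
  eapply Rle_trans; [apply HE|].
  rewrite !Rmult_assoc. apply Rmult_le_compat_l; [apply pow2_ge_0|].
  rewrite <- !exp_plus. apply exp_le.
  (* Half a unit of time at rate k a costs 13/8 L a; two values of atan differ by less than PI <= 4,
     which costs 8 k = 26 L. *)
  assert (k * a * (q - p) <= k * a * / 2).
  { apply Rmult_le_compat_l; [|easy]. apply Rmult_le_pos; lra. }
  assert (2 * k * (atan (u1 q) - atan (u1 p)) <= 2 * k * 4)
    by (apply Rmult_le_compat_l; lra).
  unfold k in *. lra.
Qed.

(** The smallness hypothesis makes [difference_growth] keep the two solutions within 1/2 of each
    other over the whole period, as the crossing estimate requires. *)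
Lemma return_map_contraction :
  Rabs (u1 0) <= 4 * (N / a) -> Rabs (u2 0) <= 4 * (N / a) ->
  Rabs (u1 0 - u2 0) * exp (4 * N * L) <= / 2 ->
  Rabs (u1 4 - u2 4) <=
    exp (26 * L + 13 / 8 * L * a) * exp (- (kap / 12) / eps) * Rabs (u1 0 - u2 0).
Proof.
  intros H1 H2 Hsmall.
  set (G := 26 * L + 13 / 8 * L * a).
  assert (Hclose : forall x, 0 <= x <= 4 -> Rabs (w x) <= / 2).
  { intros x Hx. eapply Rle_trans; [now apply difference_growth | easy]. }
  assert (Hpos : forall x, 0 <= x <= / 2 \/ 3 / 2 <= x <= 2 \/ 5 / 2 <= x <= 7 / 2 ->
    0 <= m x * jump x).
  { intros x Hx. apply Rmult_le_pos; [|apply jump_nonneg]. unfold m.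
    destruct Hx as [Hx | [Hx | Hx]].
    - apply Rmult_le_pos; [apply cos_PI_nonneg | apply sin_half_PI_nonneg]; lra.
    - apply Rmult_le_pos; [apply cos_PI_nonneg | apply sin_half_PI_nonneg]; lra.
    - assert (A1 := cos_PI_nonpos x Hx).
      assert (A2 := sin_half_PI_nonpos x ltac:(lra)). nra. }
  assert (E1 : w (/ 2) ^ 2 <= w 0 ^ 2).
  { apply sqr_difference_nonincreasing; try lra.
    intros x Hx. apply Hpos; lra. }
  assert (E2 : w (3 / 2) ^ 2 <= w (/ 2) ^ 2).
  { apply sqr_difference_nonincreasing; try lra.
    intros x Hx. unfold jump.
    assert (Hs := scale_ge).
    assert (B1 := solution_below_layer u1 sol1 H1 x Hx).
    assert (B2 := solution_below_layer u2 sol2 H2 x Hx).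
    rewrite !(pf_left P) by lra. right; ring. }
  assert (E3 : w 2 ^ 2 <= w (3 / 2) ^ 2).
  { apply sqr_difference_nonincreasing; try lra.
    intros x Hx. apply Hpos; lra. }
  assert (E4 : w (5 / 2) ^ 2 <= w 2 ^ 2 * exp G).
  { apply sqr_difference_crossing; try lra.
    intros x Hx. split; [apply cos_PI_nonneg; lra | apply Hclose; lra]. }
  assert (E5 : w 3 ^ 2 <= w (5 / 2) ^ 2).
  { apply sqr_difference_nonincreasing; try lra.
    intros x Hx. apply Hpos; lra. }
  assert (E6 := sqr_difference_sliding H1 H2).
  assert (E7 : w (7 / 2) ^ 2 <= w (19 / 6) ^ 2).
  { apply sqr_difference_nonincreasing; try lra.
    intros x Hx. apply Hpos; lra. }
  assert (E8 : w 4 ^ 2 <= w (7 / 2) ^ 2 * exp G).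
  { apply sqr_difference_crossing; try lra.
    intros x Hx. split; [apply cos_PI_nonneg; lra | apply Hclose; lra]. }
  assert (HG := exp_pos G).
  set (S := exp (- (kap * N) / 6)) in *.
  assert (HS : 0 < S) by apply exp_pos.
  apply Rabs_le_of_sqr_le.
  { apply Rmult_le_pos; [|apply Rabs_pos].
    apply Rmult_le_pos; left; apply exp_pos. }
  rewrite !Rpow_mult_distr, pow2_abs. fold (w 0). fold (w 4).
  (* Square roots: the sliding factor for w^2 has exponent kap/6, and the two crossings contribute
     exp G each, hence one exp G for |w|. *)
  replace (exp (- (kap / 12) / eps) ^ 2) with S.
  2: { replace (exp (- (kap / 12) / eps) ^ 2) with
         (exp (- (kap / 12) / eps) * exp (- (kap / 12) / eps)) by ring.
       rewrite <- exp_plus. unfold S, N. f_equal. field. lra. }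
  replace (exp G ^ 2 * S * w 0 ^ 2) with (w 0 ^ 2 * exp G * S * exp G) by ring.
  eapply Rle_trans; [apply E8|]. apply Rmult_le_compat_r; [lra|].
  eapply Rle_trans; [apply E7|].
  eapply Rle_trans; [apply E6|]. apply Rmult_le_compat_r; [lra|].
  eapply Rle_trans; [apply E5|].
  eapply Rle_trans; [apply E4|]. apply Rmult_le_compat_r; lra.
Qed.

End Comparison.


(** * The flow on the half-line and the fixed point of the return map *)

Let gsol (u : R -> R) : Prop := is_solution psi a eps u (fun x => 0 <= x).

Lemma gsol_sol (u : R -> R) : gsol u -> sol u.
Proof. intros H x Hx. apply H; lra. Qed.

Lemma field_lipschitz (x u v : R) :
  Rabs (F psi a eps x u - F psi a eps x v) <= (a + N * L) * Rabs (u - v).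
Proof.
  assert (HN : 0 < N) by (apply Rinv_0_lt_compat; lra).
  assert (Hm := divergence_bounds x).
  assert (Hl := pf_lip P u v).
  rewrite !field_eq.
  replace (- a * u - N * ((1 + (1 + psi u) * cos (PI * x)) * sin (PI * x / 2)) -
    (- a * v - N * ((1 + (1 + psi v) * cos (PI * x)) * sin (PI * x / 2)))) with
    (- (a * (u - v)) + - (N * ((cos (PI * x) * sin (PI * x / 2)) * (psi u - psi v))))
    by ring.
  eapply Rle_trans; [apply Rabs_triang|].
  rewrite !Rabs_Ropp, Rmult_plus_distr_r.
  rewrite Rabs_mult, (Rabs_right a) by lra.
  rewrite Rabs_mult, (Rabs_right N) by lra.
  apply Rplus_le_compat_l. rewrite (Rmult_assoc N L).
  apply Rmult_le_compat_l; [lra|].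
  rewrite Rabs_mult.
  assert (Rabs (cos (PI * x) * sin (PI * x / 2)) <= 1) by (apply Rabs_le; lra).
  assert (H1 := Rabs_pos (psi u - psi v)).
  assert (H2 := Rabs_pos (cos (PI * x) * sin (PI * x / 2))).
  nra.
Qed.

Lemma field_continuous (g : R -> R) :
  (forall x, continuous g x) -> forall x, continuous (fun s => F psi a eps s (g s)) x.
Proof.
  intros Hg x.
  apply (continuous_ext (fun s => - a * g s +
    (- N) * ((1 + (1 + psi (g s)) * cos (PI * s)) * sin (PI * s / 2)))).
  { intros s. rewrite field_eq. simpl. ring. }
  assert (Hp : continuous (fun s => psi (g s)) x).
  { apply (continuous_comp g psi); [apply Hg|].
    apply (ex_derive_continuous psi). eexists. apply (pf_derive P). }
  assert (Hc : continuous (fun s => cos (PI * s)) x).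
  { apply (ex_derive_continuous (fun s => cos (PI * s))). now auto_derive. }
  assert (Hs : continuous (fun s => sin (PI * s / 2)) x).
  { apply (ex_derive_continuous (fun s => sin (PI * s / 2))). now auto_derive. }
  apply (continuous_plus (fun s => - a * g s)).
  - apply (continuous_scal_r (- a) g), Hg.
  - apply (continuous_scal_r (- N)
      (fun s => (1 + (1 + psi (g s)) * cos (PI * s)) * sin (PI * s / 2))).
    apply (continuous_mult (fun s => 1 + (1 + psi (g s)) * cos (PI * s)));
      [|exact Hs].
    apply (continuous_plus (fun _ => 1)); [apply continuous_const|].
    apply (continuous_mult (fun s => 1 + psi (g s))); [|exact Hc].
    apply (continuous_plus (fun _ => 1)); [apply continuous_const | exact Hp].
Qed.

Lemma flow (u0 : R) : {u : R -> R | u 0 = u0 /\ gsol u}.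
Proof.
  assert (HN : 0 < N) by (apply Rinv_0_lt_compat; lra).
  assert (HL := pf_L P).
  apply (picard_lindelof (F psi a eps) (a + N * L) (a * Rabs u0 + 3 * N)).
  - assert (0 < N * L) by (apply Rmult_lt_0_compat; lra). lra.
  - apply field_lipschitz.
  - apply field_continuous.
  - intros x. assert (H := field_bound x u0).
    replace (F psi a eps x u0) with (- (a * u0) + (F psi a eps x u0 + a * u0)) by ring.
    eapply Rle_trans; [apply Rabs_triang|].
    rewrite Rabs_Ropp, Rabs_mult, (Rabs_right a) by lra. lra.
Qed.

(** A shift by 2 preserves cos(pi x) but flips sin(pi x / 2), so two such shifts are needed. *)
Lemma field_shift (n : nat) (x v : R) :
  F psi a eps (x + 4 * INR n) v = F psi a eps x v.
Proof.
  induction n as [|n IH].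
  - simpl. now rewrite Rmult_0_r, Rplus_0_r.
  - rewrite <- IH, S_INR.
    set (y := x + 4 * INR n).
    replace (x + 4 * (INR n + 1)) with (y + 2 + 2) by (unfold y; ring).
    rewrite !field_eq, !cos_PI_add_2, !sin_half_PI_add_2. ring.
Qed.

Lemma gsol_shift (u : R -> R) (n : nat) :
  gsol u -> gsol (fun x => u (x + 4 * INR n)).
Proof.
  intros Hu x Hx. assert (Hn := pos_INR n).
  assert (H := Hu (x + 4 * INR n) ltac:(lra)).
  rewrite field_shift in H.
  rewrite <- (Rmult_1_l (F psi a eps x _)).
  apply (is_derive_comp u (fun x => x + 4 * INR n)); [easy|].
  auto_derive; [easy | ring].
Qed.

Lemma period_index (x : R) :
  0 <= x -> exists n : nat, 0 <= x - 4 * INR n <= 4.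
Proof.
  intros Hx. destruct (nfloor_ex (x / 4)) as [n Hn]; [lra|].
  exists n. lra.
Qed.

(** On this interval the available Lipschitz constant is the huge exp(4 N L); it yields continuity
    only, so invariance and a sign change of [ret x - x] replace the contraction principle. *)
Lemma return_fixed_point :
  exists v, gsol v /\ Rabs (v 0) <= 3 * (N / a) /\ v 4 = v 0.
Proof.
  set (ret u0 := proj1_sig (flow u0) 4).
  assert (Hs := scale_pos).
  assert (Hlip : forall x y, Rabs (ret x - ret y) <= Rabs (x - y) * exp (4 * N * L)).
  { intros x y. unfold ret.
    destruct (flow x) as [u [Hu0 Hu]], (flow y) as [v [Hv0 Hv]]. simpl.
    rewrite <- Hu0, <- Hv0.
    apply difference_growth; [now apply gsol_sol | now apply gsol_sol | lra]. }
  assert (Hin : forall x, Rabs x <= 3 * (N / a) -> Rabs (ret x) <= 3 * (N / a)).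
  { intros x Hx. unfold ret. destruct (flow x) as [u [Hu0 Hu]]. simpl.
    apply solution_bounded; [now apply gsol_sol | lra | now rewrite Hu0 | lra]. }
  set (b := 3 * (N / a)) in *.
  destruct (IVT_cor (fun x => ret x - x) (- b) b) as [z [Hz E]].
  - intros x e He.
    set (K := exp (4 * N * L) + 1).
    assert (HK := exp_pos (4 * N * L)).
    exists (e / K). split; [apply Rdiv_lt_0_compat; unfold K; lra|].
    intros y [_ Hy]. simpl in *. unfold Rdist in *.
    specialize (Hlip y x).
    replace (ret y - y - (ret x - x)) with ((ret y - ret x) + - (y - x)) by ring.
    eapply Rle_lt_trans; [apply Rabs_triang|]. rewrite Rabs_Ropp.
    apply Rle_lt_trans with (Rabs (y - x) * K); [unfold K; lra|].
    apply Rlt_le_trans with (e / K * K).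
    + apply Rmult_lt_compat_r; [unfold K; lra | easy].
    + right. field. unfold K; lra.
  - unfold b; lra.
  - assert (H1 := Hin (- b) ltac:(rewrite Rabs_Ropp, Rabs_right; unfold b; lra)).
    assert (H2 := Hin b ltac:(rewrite Rabs_right; unfold b; lra)).
    apply Rabs_le_between in H1, H2. nra.
  - exists (proj1_sig (flow z)). unfold ret in E.
    destruct (flow z) as [v [Hv0 Hv]]. simpl in *.
    rewrite Hv0. split; [easy|]. split; [apply Rabs_le; lra | lra].
Qed.

(** * The periodic orbit: sliding, contraction and stability *)

Section Orbit.

Context (v : R -> R) (v_sol : gsol v) (v_range : Rabs (v 0) <= 3 * (N / a)).
Context (v_return : v 4 = v 0).

(** Uniqueness: the shifted and the original solution agree at 0, so [difference_growth] forces
    distance zero. It covers one period only, hence the induction, in which the value at 4 starts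
    the next period. *)
Lemma orbit_shift (n : nat) (x : R) : 0 <= x <= 4 -> v (x + 4 * INR n) = v x.
Proof.
  revert x. induction n as [|n IH]; intros x Hx.
  - simpl. now rewrite Rmult_0_r, Rplus_0_r.
  - assert (H := difference_growth (fun y => v (y + 4 * INR (S n))) v
      (gsol_sol _ (gsol_shift v (S n) v_sol)) (gsol_sol _ v_sol) x Hx).
    cbv beta in H.
    assert (E : v (0 + 4 * INR (S n)) = v 0).
    { rewrite <- v_return, <- (IH 4) by lra. rewrite S_INR. f_equal. ring. }
    rewrite E, Rminus_eq_0, Rabs_R0, Rmult_0_l in H.
    assert (H0 := Rabs_pos (v (x + 4 * INR (S n)) - v x)).
    apply Rminus_diag_uniq.
    destruct (Req_dec (v (x + 4 * INR (S n)) - v x) 0) as [|Hne]; [easy|].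
    apply Rabs_pos_lt in Hne. lra.
Qed.

Lemma orbit_periodic (x : R) : 0 <= x -> v (x + 4) = v x.
Proof.
  intros Hx. destruct (period_index x Hx) as [n Hn].
  assert (H1 := orbit_shift n (x - 4 * INR n) Hn).
  assert (H2 := orbit_shift (S n) (x - 4 * INR n) Hn).
  rewrite S_INR in H2.
  replace (x - 4 * INR n + 4 * INR n) with x in H1 by ring.
  replace (x - 4 * INR n + 4 * (INR n + 1)) with (x + 4) in H2 by ring.
  congruence.
Qed.

Lemma orbit_sliding :
  sliding psi eps ((2 * (a * L + 8) + 48) / kap) (/ 6) v.
Proof.
  assert (Hs := scale_pos).
  assert (Hlo := pf_lo P). assert (Hhi := pf_hi P).
  (* n = 1 selects the attracting branch over (8/3, 10/3); starting at 3 instead of 35/12 leaves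
     time for [psi v - crit] to become O(eps). *)
  exists 1%Z, 3, (19 / 6).
  do 4 (split; [lra|]).
  intros x Hx.
  assert (H0 : Rabs (v 0) <= 4 * (N / a)) by lra.
  assert (Hw := solution_in_window v (gsol_sol _ v_sol) H0 x ltac:(lra)).
  split; [apply Rabs_def1; lra|].
  now apply solution_near_crit; [apply gsol_sol | |].
Qed.

(** The first bound keeps initial values below 3N/a + N/a. By the second, two of them differ by at
    most exp(-4 N L) / 2, so their solutions stay within 1/2. *)
Let delta : R := Rmin (N / a) (/ exp (4 * N * L) / 4).
Let theta : R := exp (26 * L + 13 / 8 * L * a) * exp (- (kap / 12) / eps).

Lemma delta_pos : 0 < delta.
Proof.
  apply Rmin_glb_lt; [apply scale_pos|].
  assert (H := Rinv_0_lt_compat _ (exp_pos (4 * N * L))). lra.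
Qed.

Lemma orbit_return_map (u1 u2 : R -> R) :
  sol u1 -> sol u2 -> Rabs (u1 0 - v 0) <= delta -> Rabs (u2 0 - v 0) <= delta ->
  Rabs (u1 4 - u2 4) <= theta * Rabs (u1 0 - u2 0).
Proof.
  intros S1 S2 H1 H2.
  assert (D1 : delta <= N / a) by apply Rmin_l.
  assert (D2 : delta <= / exp (4 * N * L) / 4) by apply Rmin_r.
  apply return_map_contraction; [easy | easy | | |].
  - replace (u1 0) with (u1 0 - v 0 + v 0) by ring.
    eapply Rle_trans; [apply Rabs_triang|]. lra.
  - replace (u2 0) with (u2 0 - v 0 + v 0) by ring.
    eapply Rle_trans; [apply Rabs_triang|]. lra.
  - assert (He := exp_pos (4 * N * L)).
    apply Rmult_le_reg_r with (/ exp (4 * N * L)); [now apply Rinv_0_lt_compat|].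
    rewrite Rmult_assoc, Rinv_r, Rmult_1_r by lra.
    replace (u1 0 - u2 0) with ((u1 0 - v 0) + - (u2 0 - v 0)) by ring.
    eapply Rle_trans; [apply Rabs_triang|]. rewrite Rabs_Ropp. lra.
Qed.

Context (theta_lt1 : theta < 1).

Lemma theta_pos : 0 < theta.
Proof. apply Rmult_lt_0_compat; apply exp_pos. Qed.

(** Since theta^n <= 1, the iterates remain in the neighbourhood where the contraction applies. *)
Lemma orbit_iterated_return (u : R -> R) (n : nat) :
  gsol u -> Rabs (u 0 - v 0) <= delta ->
  Rabs (u (4 * INR n) - v 0) <= theta ^ n * Rabs (u 0 - v 0).
Proof.
  intros Hu H0. assert (Ht := theta_pos).
  induction n as [|n IH].
  - simpl. rewrite Rmult_0_r. lra.
  - assert (Hn : theta ^ n <= 1) by (rewrite <- (pow1 n); apply pow_incr; lra).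
    assert (H := orbit_return_map (fun x => u (x + 4 * INR n)) v
      (gsol_sol _ (gsol_shift u n Hu)) (gsol_sol _ v_sol)).
    cbv beta in H. rewrite v_return, Rplus_0_l in H.
    rewrite S_INR. replace (4 * (INR n + 1)) with (4 + 4 * INR n) by ring.
    assert (Hp := Rabs_pos (u 0 - v 0)).
    eapply Rle_trans; [apply H|].
    + eapply Rle_trans; [apply IH|]. nra.
    + rewrite Rminus_eq_0, Rabs_R0. left; apply delta_pos.
    + simpl. rewrite Rmult_assoc. apply Rmult_le_compat_l; lra.
Qed.

(** Between returns the crude growth bound suffices: eps is fixed, so it is a constant beaten by
    theta^n. *)
Lemma orbit_attracts (u : R -> R) (n : nat) (x : R) :
  gsol u -> Rabs (u 0 - v 0) <= delta -> 0 <= x - 4 * INR n <= 4 ->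
  Rabs (u x - v x) <= theta ^ n * Rabs (u 0 - v 0) * exp (4 * N * L).
Proof.
  intros Hu H0 Hx.
  assert (H := difference_growth (fun y => u (y + 4 * INR n))
    (fun y => v (y + 4 * INR n))
    (gsol_sol _ (gsol_shift u n Hu)) (gsol_sol _ (gsol_shift v n v_sol)) _ Hx).
  cbv beta in H.
  replace (x - 4 * INR n + 4 * INR n) with x in H by ring.
  rewrite (orbit_shift n 0), Rplus_0_l in H by lra.
  eapply Rle_trans; [apply H|].
  apply Rmult_le_compat_r; [left; apply exp_pos|].
  now apply orbit_iterated_return.
Qed.

Lemma orbit_stable : loc_asym_stable psi a eps v.
Proof.
  assert (Hd := delta_pos). assert (Ht := theta_pos).
  assert (He := exp_pos (4 * N * L)). set (E := exp (4 * N * L)) in *.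
  split.
  - intros eta Heta.
    exists (Rmin delta (eta / E)). split.
    { apply Rmin_glb_lt; [easy|]. now apply Rdiv_lt_0_compat. }
    intros u Hu H0 x Hx.
    assert (D1 := Rmin_l delta (eta / E)). assert (D2 := Rmin_r delta (eta / E)).
    destruct (period_index x Hx) as [n Hn].
    assert (Htn : theta ^ n <= 1) by (rewrite <- (pow1 n); apply pow_incr; lra).
    eapply Rle_lt_trans; [apply (orbit_attracts u n x Hu ltac:(lra) Hn)|].
    fold E. assert (Hp := Rabs_pos (u 0 - v 0)).
    apply Rle_lt_trans with (Rabs (u 0 - v 0) * E).
    + apply Rmult_le_compat_r; [lra|]. nra.
    + apply Rlt_le_trans with (eta / E * E).
      * apply Rmult_lt_compat_r; lra.
      * right; field; lra.
  - exists delta. split; [easy|].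
    intros u Hu H0. apply is_lim_spec. intros e.
    assert (Hlim : is_lim_seq (fun n => theta ^ n * (delta * E)) (0 * (delta * E))).
    { apply (is_lim_seq_scal_r _ (delta * E) 0). apply is_lim_seq_geom.
      rewrite Rabs_right; lra. }
    rewrite Rmult_0_l in Hlim. apply is_lim_seq_spec in Hlim.
    destruct (Hlim e) as [n0 Hn0].
    (* The extra 4 accounts for the position of x within its period and ensures n >= n0. *)
    exists (4 * INR n0 + 4). intros x Hx.
    assert (Hp0 := pos_INR n0).
    destruct (period_index x ltac:(lra)) as [n Hn].
    assert (Hle : (n0 <= n)%nat) by (apply INR_le; lra).
    specialize (Hn0 n Hle). rewrite Rminus_0_r in Hn0 |- *.
    apply Rabs_def2 in Hn0.
    eapply Rle_lt_trans; [apply (orbit_attracts u n x Hu ltac:(lra) Hn)|].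
    fold E. assert (Hp := Rabs_pos (u 0 - v 0)).
    assert (Htn : 0 < theta ^ n) by now apply pow_lt.
    apply Rle_lt_trans with (theta ^ n * (delta * E)); [|lra].
    rewrite Rmult_assoc. apply Rmult_le_compat_l; [lra|].
    apply Rmult_le_compat_r; lra.
Qed.

End Orbit.

End Dynamics.

Theorem theorem6 (psi : R -> R) :
  transition psi ->
  exists a1, 0 < a1 /\
  forall a, a1 < a ->
  exists eps0 K ell c C,
    0 < eps0 /\ 0 < K /\ 0 < ell /\ 0 < c /\ 0 < C /\
    forall eps, 0 < eps < eps0 ->
    exists v : R -> R,
      is_solution psi a eps v (fun x => 0 <= x) /\
      (forall x, 0 <= x -> v (x + 4) = v x) /\
      sliding psi eps K ell v /\
      loc_asym_stable psi a eps v /\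
      (* Poincare return map v(0) |-> v(4) on a neighbourhood of v(0) has
         Lipschitz constant C exp(-c/eps) *)
      (exists delta, 0 < delta /\
         forall u1 u2 : R -> R,
           is_solution psi a eps u1 (fun x => 0 <= x <= 4) ->
           is_solution psi a eps u2 (fun x => 0 <= x <= 4) ->
           Rabs (u1 0 - v 0) <= delta -> Rabs (u2 0 - v 0) <= delta ->
           Rabs (u1 4 - u2 4) <= C * exp (- c / eps) * Rabs (u1 0 - u2 0)).
Proof.
  intros Hpsi.
  destruct (transition_profile psi Hpsi) as (psi1 & L & kap & lo & hi & P).
  assert (HL := pf_L P). assert (Hk := pf_kap P).
  exists 600. split; [lra|].
  intros a Ha.
  set (C := exp (26 * L + 13 / 8 * L * a)).
  assert (HC : 0 < C) by apply exp_pos.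
  (* The first bound on eps gives N >= 100 a. The second gives t = kap / (12 eps) > C, so C exp(-t)
     <= C / (1 + t) < 1, the strict contraction that stability needs. *)
  exists (Rmin (/ (100 * a)) (kap / 12 / C)), ((2 * (a * L + 8) + 48) / kap), (/ 6),
    (kap / 12), C.
  assert (Hi : 0 < / (100 * a)) by (apply Rinv_0_lt_compat; lra).
  assert (0 < a * L) by (apply Rmult_lt_0_compat; lra).
  split; [apply Rmin_glb_lt; [easy | apply Rdiv_lt_0_compat; lra]|].
  split; [apply Rdiv_lt_0_compat; lra|].
  do 3 (split; [lra|]).
  intros eps [Heps Heps0].
  assert (Hmin1 := Rmin_l (/ (100 * a)) (kap / 12 / C)).
  assert (Hmin2 := Rmin_r (/ (100 * a)) (kap / 12 / C)).
  assert (Ha' : 600 <= a) by lra.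
  assert (Hinv : 100 * a <= / eps).
  { rewrite <- (Rinv_inv (100 * a)). apply Rinv_le_contravar; lra. }
  assert (Hth : C * exp (- (kap / 12) / eps) < 1).
  { set (t := kap / 12 / eps).
    assert (Ht : C < t).
    { unfold t. apply Rmult_lt_reg_r with eps; [easy|].
      replace (kap / 12 / eps * eps) with (kap / 12) by (field; lra).
      replace (kap / 12) with (C * (kap / 12 / C)) by (field; lra).
      apply Rmult_lt_compat_l; lra. }
    replace (- (kap / 12) / eps) with (- t) by (unfold t; field; lra).
    apply Rle_lt_trans with (C * / (1 + t)).
    - apply Rmult_le_compat_l; [lra|]. apply exp_neg_le_inv; lra.
    - apply Rmult_lt_reg_r with (1 + t); [lra|].
      rewrite Rmult_assoc, Rinv_l; lra. }
  destruct (return_fixed_point psi psi1 L kap lo hi a eps P Ha' Heps)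
    as (v & Hv & Hv0 & Hv4).
  exists v. split; [easy|].
  split; [eapply orbit_periodic; eassumption|].
  split; [eapply orbit_sliding; eassumption|].
  split; [eapply orbit_stable; eassumption|].
  eexists. split; [|eapply orbit_return_map; eassumption].
  eapply delta_pos; eassumption.
Qed.
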